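(* For any differential graded algebra $(V,\bullet,\partial)$ there is a $B_\infty$ structure $(\mu_\bullet,d_\partial)$ on $V$ uniquely defined by $$p_1\circ\mu_\bullet=\bullet\circ(p_1\otimes p_1)\colon\overline T^c(V)\otimes\overline T^c(V)\to V,\qquad p_1\circ d_\partial=\partial\circ p_1\colon\overline T^c(V)\to V.$$ All of its operations $m_{i,j}$ ($i,j\ge0$) and $m_n$ ($n\ge1$) are zero, except $m_{1,1}=\bullet$, $m_1=\partial$, and $m_{0,1}=m_{1,0}=\mathrm{id}$ (the canonical identifications $\mathbb K\otimes V=V=V\otimes\mathbb K$).
   Context: Conventions. Vector spaces are $\mathbb Z$-graded over a field $\mathbb K$; maps have degree $0$ unless stated otherwise; the Koszul sign rule is used: $(f\otimes g)(a\otimes b)=(-1)^{|g||a|}f(a)\otimes g(b)$ and the symmetry is $a\otimes b\mapsto(-1)^{|a||b|}b\otimes a$. A differential graded algebra is a unital associative graded algebra with a map $\partial$ of degree $-1$ satisfying $\partial^2=0$ and the (signed) Leibniz rule. Tensor coalgebra. $T^c(V)=\bigoplus_{k\ge0}V^{\otimes k}$ with deconcatenation $\Delta(v_1\cdots v_k)=\sum_{i=0}^k v_1\cdots v_i\otimes v_{i+1}\cdots v_k$, counit the projection to $V^{\otimes0}=\mathbb K$, and unit $1=1_{\mathbb K}$; $\overline T^c(V)=\bigoplus_{k\ge1}V^{\otimes k}$; $p_1\colon T^c(V)\to V$ is the projection. $B_\infty$ structure (in the shifted convention). A $B_\infty$ structure on $V$ is a pair $(\mu,d)$ where $\mu\colon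 T^c(V)\otimes T^c(V)\to T^c(V)$ is a coalgebra map of degree $0$ that is associative and satisfies $\mu(1\otimes x)=x=\mu(x\otimes 1)$, and $d\colon T^c(V)\to T^c(V)$ is a coderivation ($\Delta d=(d\otimes\mathrm{id}+\mathrm{id}\otimes d)\Delta$) of degree $-1$ with $d(1)=0$, $d^2=0$ and $d\mu=\mu(d\otimes\mathrm{id}+\mathrm{id}\otimes d)$. Its operations are $m_n=p_1d|_{V^{\otimes n}}\colon V^{\otimes n}\to V$ and $m_{i,j}=p_1\mu|_{V^{\otimes i}\otimes V^{\otimes j}}\colon V^{\otimes i}\otimes V^{\otimes j}\to V$. *)

(* Defs.v *)
From HB Require Import structures.
From mathcomp Require Import all_boot ssralg ssrint ring_quotient sesquilinear.
From mathcomp Require Import boolp classical_sets fsbigop.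
From mathcomp.multinomials Require Import freeg.

Set Implicit Arguments.
Unset Strict Implicit.
Unset Printing Implicit Defensive.

Import GRing.Theory.

Local Open Scope ring_scope.

Lemma linear_eq0 (K : fieldType) (U W : lmodType K) (f : U -> W) :
  linear f -> f 0 = 0.
Proof.
move=> lf; have := lf 1 0 0.
by rewrite !scale1r addr0 => /esym/(canRL (addrK _)); rewrite subrr.
Qed.

Lemma fglift_linear (K : fieldType) (X : choiceType) (W : lmodType K)
  (f : X -> W) : linear (fglift f : {freeg X / K} -> W).
Proof.
have addf := lift_is_additive f; have f0 : fglift f 0 = 0.
  by rewrite -(subrr 0) addf subrr.
have fN : {morph fglift f : x / - x} by move=> x; rewrite -sub0r addf f0 sub0r.
have fD : {morph fglift f : x y / x + y}.
  by move=> x y; rewrite -{1}[y]opprK addf fN opprK.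
move=> a x y; rewrite fD; congr (_ + _).
elim/freeg_ind_dom0: x => [|k z D _ _ IH]; first by rewrite scaler0 f0 scaler0.
rewrite scalerDr !fD IH scalerDr; congr (_ + _).
have -> : a *: << k *g z >> = << (a * k) *g z >>.
  by apply/eqP/freeg_eqP => t; rewrite coeffZ !coeffU mulrA.
by rewrite !liftU scalerA.
Qed.

HB.instance Definition _ (K : fieldType) (X : choiceType) (W : lmodType K)
  (f : X -> W) := GRing.isLinear.Build K {freeg X / K} W *:%R (fglift f)
  (fglift_linear f).

Lemma freeg_span (K : fieldType) (X : choiceType) (P : {freeg X / K} -> Prop) :
  P 0 -> (forall a u v, P u -> P v -> P (a *: u + v)) ->
  (forall x, P << x >>) -> forall D, P D.
Proof.
move=> P0 PD PX; elim/freeg_ind_dom0 => [|k z D _ _ IH] //.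
have -> : << k *g z >> = k *: << z >> :> {freeg X / K}.
  by apply/eqP/freeg_eqP => t; rewrite coeffZ !coeffU mul1r.
exact: PD.
Qed.

Section QuotientModule.

Variables (K : fieldType) (M : lmodType K) (R : M -> Prop).

(* Membership in the submodule generated by R, i.e. in the smallest one
   containing R. *)
Definition gensub : {pred M} := fun x => `[< forall P : M -> Prop,
  P 0 -> (forall a u v, P u -> P v -> P (a *: u + v)) ->
  (forall r, R r -> P r) -> P x >].

Lemma gensub_gen r : R r -> r \in gensub.
Proof. by move=> Rr; apply/asboolP => P _ _; apply. Qed.

Lemma gensub0 : 0 \in gensub.
Proof. by apply/asboolP. Qed.

Lemma gensubP a : {in gensub &, forall u v, a *: u + v \in gensub}.
Proof.
move=> u v /asboolP Gu /asboolP Gv; apply/asboolP => P P0 PD PR.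
by apply: (PD); [apply: Gu | apply: Gv].
Qed.

Lemma gensub_zmod_closed : zmod_closed gensub.
Proof.
split; first exact: gensub0.
by move=> u v Gu Gv; rewrite addrC -scaleN1r; apply: gensubP.
Qed.

HB.instance Definition _ := GRing.isZmodClosed.Build M gensub gensub_zmod_closed.

Lemma gensubZ a u : u \in gensub -> a *: u \in gensub.
Proof. by move=> Gu; rewrite -[_ *: _]addr0; apply: gensubP => //; apply: gensub0. Qed.

Definition quotmod : Type := Quotient.quot gensub.
HB.instance Definition _ := GRing.Zmodule.on quotmod.

Definition quotpi (x : M) : quotmod := (\pi_(Quotient.quot gensub) x)%qT.
Definition quotrepr (q : quotmod) : M := repr (q : Quotient.quot gensub).
Definition quotscale (a : K) (q : quotmod) : quotmod := quotpi (a *: quotrepr q).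

Lemma quotreprK q : quotpi (quotrepr q) = q. Proof. exact: reprK. Qed.

Lemma quotpi_eq x y : quotpi x = quotpi y <-> x - y \in gensub.
Proof. by rewrite Quotient.idealrBE; split=> [/eqP|/eqP]. Qed.

Lemma quotpi_zmod : {morph quotpi : x y / x + y}.
Proof. by move=> x y; rewrite /quotpi piE. Qed.

Lemma quotpi_scale a x : quotpi (a *: x) = quotscale a (quotpi x).
Proof.
apply/quotpi_eq; rewrite -scalerBr; apply: gensubZ.
by apply/quotpi_eq; rewrite quotreprK.
Qed.

Lemma quotscaleA a b q : quotscale a (quotscale b q) = quotscale (a * b) q.
Proof. by rewrite -[q]quotreprK -!quotpi_scale scalerA. Qed.
Lemma quotscale1 : left_id 1 quotscale.
Proof. by move=> q; rewrite -[q]quotreprK -!quotpi_scale scale1r. Qed.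
Lemma quotscaleDr : right_distributive quotscale +%R.
Proof.
move=> a p q; rewrite -[p]quotreprK -[q]quotreprK.
by rewrite -quotpi_zmod -!quotpi_scale -quotpi_zmod scalerDr.
Qed.
Lemma quotscaleDl q : {morph quotscale^~ q : a b / a + b}.
Proof.
by move=> a b; rewrite -[q]quotreprK -!quotpi_scale scalerDl quotpi_zmod.
Qed.

HB.instance Definition _ := GRing.Zmodule_isLmodule.Build K quotmod
  quotscaleA quotscale1 quotscaleDr quotscaleDl.

Lemma quotpi_linear : linear quotpi.
Proof. by move=> a x y; rewrite quotpi_zmod quotpi_scale. Qed.

HB.instance Definition _ :=
  GRing.isLinear.Build K M quotmod *:%R quotpi quotpi_linear.

Lemma quotpi_rel x a y z : R (x - (a *: y + z)) ->
  quotpi x = a *: quotpi y + quotpi z.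
Proof. by move=> Rx; rewrite -quotpi_linear; apply/quotpi_eq/gensub_gen. Qed.

(* The map induced on the quotient; meaningful when f is linear and vanishes
   on R, see quotliftE. *)
Definition quotlift (W : Type) (f : M -> W) (q : quotmod) : W := f (quotrepr q).

Section Lift.
Variables (W : lmodType K) (f : M -> W).
Hypotheses (lf : linear f) (fR : forall r, R r -> f r = 0).

Lemma quotliftE x : quotlift f (quotpi x) = f x.
Proof.
have f0 := linear_eq0 lf.
have : quotrepr (quotpi x) - x \in gensub by apply/quotpi_eq; rewrite quotreprK.
move=> /asboolP /(_ (fun z => f z = 0)) H.
have -> : quotlift f (quotpi x) = f (1 *: (quotrepr (quotpi x) - x) + x).
  by rewrite scale1r subrK.
rewrite lf H ?scaler0 ?add0r // => a u v fu fv.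
by rewrite lf fu fv scaler0 addr0.
Qed.

Lemma quotlift_linear : linear (quotlift f).
Proof.
move=> a p q; rewrite -[p]quotreprK -[q]quotreprK -quotpi_linear.
by rewrite !quotliftE lf.
Qed.
End Lift.

End QuotientModule.

Section Tensor.

Variables (K : fieldType) (U W : lmodType K).

Inductive bilinear_rel : {freeg (U * W)%type / K} -> Prop :=
| BilinearRelL a u u' w : bilinear_rel
    (<< (a *: u + u', w) >> - (a *: << (u, w) >> + << (u', w) >>))
| BilinearRelR a u w w' : bilinear_rel
    (<< (u, a *: w + w') >> - (a *: << (u, w) >> + << (u, w') >>)).

Definition tens : Type := quotmod bilinear_rel.
HB.instance Definition _ := GRing.Lmodule.on tens.

Definition tpure (u : U) (w : W) : tens := quotpi bilinear_rel << (u, w) >>.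

Lemma tpure_bilinear : bilinear_for *:%R *:%R tpure.
Proof.
split=> [w|u] a x y; first exact: (quotpi_rel (BilinearRelL a x y w)).
exact: (quotpi_rel (BilinearRelR a u x y)).
Qed.

HB.instance Definition _ :=
  bilinear_isBilinear.Build K U W tens *:%R *:%R tpure tpure_bilinear.

Lemma tens_ind (P : tens -> Prop) :
  P 0 -> (forall a x y, P x -> P y -> P (a *: x + y)) ->
  (forall u w, P (tpure u w)) -> forall x, P x.
Proof.
move=> P0 PD PX x; rewrite -[x]quotreprK.
elim/freeg_span: (quotrepr x) => [|a u v Pu Pv|[u w]]; last exact: PX.
  by rewrite linear0.
by rewrite linearP; apply: PD.
Qed.

End Tensor.

Arguments tens {K} U W.
Notation "x ⊗ y" := (tpure x y) (at level 40, left associativity) : ring_scope.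

Section TensorLift.

Variables (K : fieldType) (U W X : lmodType K).

(* The linear map u ⊗ w |-> f u w, for a bilinear f. *)
Definition tlift (f : U -> W -> X) : tens U W -> X :=
  quotlift (fglift (fun p : U * W => f p.1 p.2)).

Variable f : U -> W -> X.
Hypothesis bf : bilinear_for *:%R *:%R f.

Let frel r : @bilinear_rel K U W r -> fglift (fun p : U * W => f p.1 p.2) r = 0.
Proof.
case=> [a u u' w | a u w w']; rewrite linearB linearP /= !liftU /= !scale1r.
  by rewrite (bf.1 w) subrr.
by rewrite (bf.2 u) subrr.
Qed.

Lemma tliftE u w : tlift f (u ⊗ w) = f u w.
Proof. by rewrite /tlift quotliftE ?liftU ?scale1r //; apply: fglift_linear. Qed.

Lemma tlift_linear : linear (tlift f).
Proof. by apply: quotlift_linear => //; apply: fglift_linear. Qed.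

End TensorLift.

Section Words.

Variables (K : fieldType) (V : lmodType K).

Inductive multilinear_rel : {freeg (seq V) / K} -> Prop :=
| MultilinearRel w1 a x y w2 : multilinear_rel
    (<< w1 ++ (a *: x + y) :: w2 >> -
      (a *: << w1 ++ x :: w2 >> + << w1 ++ y :: w2 >>)).

(* The direct sum over k of the V^{⊗k}: generators are the words v1 ... vk,
   the relations say that a word is linear in each of its letters. *)
Definition Tc : Type := quotmod multilinear_rel.
HB.instance Definition _ := GRing.Lmodule.on Tc.

Definition word (w : seq V) : Tc := quotpi multilinear_rel << w >>.

Definition multilinear (W : lmodType K) (f : seq V -> W) :=
  forall w1 a x y w2,
    f (w1 ++ (a *: x + y) :: w2) = a *: f (w1 ++ x :: w2) + f (w1 ++ y :: w2).

Lemma word_multilinear : multilinear word.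
Proof.
by move=> w1 a x y w2; exact: (quotpi_rel (MultilinearRel w1 a x y w2)).
Qed.

Lemma Tc_ind (P : Tc -> Prop) :
  P 0 -> (forall a x y, P x -> P y -> P (a *: x + y)) ->
  (forall w, P (word w)) -> forall x, P x.
Proof.
move=> P0 PD PX x; rewrite -[x]quotreprK.
elim/freeg_span: (quotrepr x) => [|a u v Pu Pv|w]; last exact: PX.
  by rewrite linear0.
by rewrite linearP; apply: PD.
Qed.

Section TcLift.
Variable W : lmodType K.

(* The linear map v1 ... vk |-> f [:: v1; ...; vk], for a multilinear f. *)
Definition Tclift (f : seq V -> W) : Tc -> W := quotlift (fglift f).

Variable f : seq V -> W.
Hypothesis mf : multilinear f.

Let frel r : multilinear_rel r -> fglift f r = 0.
Proof.
by case=> *; rewrite linearB linearP /= !liftU !scale1r mf subrr.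
Qed.

Lemma TcliftE w : Tclift f (word w) = f w.
Proof. by rewrite /Tclift quotliftE ?liftU ?scale1r //; apply: fglift_linear. Qed.

Lemma Tclift_linear : linear (Tclift f).
Proof. by apply: quotlift_linear => //; apply: fglift_linear. Qed.
End TcLift.

End Words.

Arguments Tc {K} V.

(* A Z-grading V = ⊕_n V_n, given by the projections gcomp n : V -> V_n. *)
HB.mixin Record Lmodule_isGraded (K : fieldType) V of GRing.Lmodule K V := {
  gcomp : int -> V -> V;
  gcomp_linear : forall n, linear (gcomp n);
  gcomp_gcomp : forall m n v, gcomp m (gcomp n v) = if m == n then gcomp n v else 0;
  gcomp_sum : forall v, exists2 s : seq int, uniq s & v = \sum_(n <- s) gcomp n v
}.

#[short(type="gradedType")]
HB.structure Definition Graded (K : fieldType) :=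
  {V of GRing.Lmodule K V & Lmodule_isGraded K V}.

HB.instance Definition _ (K : fieldType) (V : gradedType K) n :=
  GRing.isLinear.Build K V V *:%R (gcomp n) (gcomp_linear n).

(* v belongs to V_n; in particular 0 is homogeneous of every degree. *)
Definition homog (K : fieldType) (V : gradedType K) (n : int) (v : V) : Prop :=
  gcomp n v = v.

Definition has_degree (K : fieldType) (V W : gradedType K) (k : int)
  (f : V -> W) : Prop := forall n v, homog n v -> homog (n + k) (f v).

Section FiniteSums.

Definition finsupport (W : zmodType) (F : int -> W) : Prop :=
  exists s : seq int, forall i, i \notin s -> F i = 0.

Lemma fsumE (W : zmodType) (F : int -> W) (s : seq int) :
  (forall i, i \notin s -> F i = 0) ->
  \sum_(i \in [set: int]) F i = \sum_(i <- undup s) F i.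
Proof.
move=> sF; rewrite -(fsbig_widen [set` undup s] setT) //; last first.
  by move=> i /= [_]; rewrite mem_undup => /negP; apply: sF.
by rewrite [RHS]fsbig_seq ?undup_uniq.
Qed.

Lemma fsum1 (W : zmodType) (F : int -> W) k :
  (forall i, i != k -> F i = 0) -> \sum_(i \in [set: int]) F i = F k.
Proof.
move=> kF; rewrite (@fsumE _ _ [:: k]) ?big_seq1 // => i.
by rewrite inE; apply: kF.
Qed.

Lemma fsum_linearP (K : fieldType) (W : lmodType K) (F G : int -> W) a :
  finsupport F -> finsupport G ->
  \sum_(i \in [set: int]) (a *: F i + G i) =
    a *: \sum_(i \in [set: int]) F i + \sum_(i \in [set: int]) G i.
Proof.
move=> [s sF] [t tG].
have sF' i : i \notin s ++ t -> F i = 0.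
  by rewrite mem_cat => /norP[? _]; apply: sF.
have tG' i : i \notin s ++ t -> G i = 0.
  by rewrite mem_cat => /norP[_ ?]; apply: tG.
rewrite !(@fsumE _ _ (s ++ t)) // ?big_split ?scaler_sumr //.
by move=> i si; rewrite sF' // tG' // scaler0 addr0.
Qed.

Lemma fsum_linear (K : fieldType) (V W : lmodType K) (h : int -> V -> W) :
  (forall i, linear (h i)) -> (forall v, finsupport (h^~ v)) ->
  linear (fun v => \sum_(i \in [set: int]) h i v).
Proof.
move=> hl hf a u v; rewrite -fsum_linearP //.
by apply: eq_fsbigr => i _; apply: hl.
Qed.

Variables (K : fieldType) (V : gradedType K).

Lemma gcomp_fin (v : V) : finsupport (fun n => gcomp n v).
Proof.
have [s _ vE] := gcomp_sum v; exists s => i si.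
rewrite vE linear_sum big_seq big1 //= => j sj; rewrite gcomp_gcomp.
by case: eqVneq => // ij; move: si; rewrite ij sj.
Qed.

Lemma gcomp_homog n (v : V) : homog n (gcomp n v).
Proof. by rewrite /homog gcomp_gcomp eqxx. Qed.

Lemma homogE m n (v : V) : homog n v -> gcomp m v = if m == n then v else 0.
Proof. by move=> <-; rewrite gcomp_gcomp. Qed.

Lemma span_sum (W : lmodType K) (P : W -> Prop) (s : seq int) (F : int -> W) :
  P 0 -> (forall a x y, P x -> P y -> P (a *: x + y)) ->
  (forall i, P (F i)) -> P (\sum_(i <- s) F i).
Proof.
move=> P0 PD PF; elim: s => [|i s IH]; rewrite ?big_nil // big_cons.
by rewrite -[F i]scale1r; apply: PD.
Qed.

End FiniteSums.

Section GradingFromGenerators.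

Variables (K : fieldType) (V : lmodType K) (comp : int -> V -> V).
Hypothesis comp_linear : forall n, linear (comp n).
Variable gen : int -> V -> Prop.
Hypothesis gen_comp : forall k n x, gen k x -> comp n x = if n == k then x else 0.
Hypothesis gen_span : forall P : V -> Prop,
  P 0 -> (forall a x y, P x -> P y -> P (a *: x + y)) ->
  (forall k x, gen k x -> P x) -> forall x, P x.

Let comp0 n : comp n 0 = 0. Proof. exact: linear_eq0. Qed.

Lemma gen_comp_comp m n v : comp m (comp n v) = if m == n then comp n v else 0.
Proof.
elim/gen_span: v => [|a x y IHx IHy|k x /gen_comp kx].
- by rewrite !comp0 if_same.
- by rewrite !comp_linear IHx IHy; case: ifP; rewrite // scaler0 addr0.
- rewrite kx; case: (eqVneq n k) => [->|nk]; first by rewrite kx.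
  by rewrite comp0 if_same.
Qed.

Lemma gen_comp_sum v : exists2 s : seq int, uniq s & v = \sum_(n <- s) comp n v.
Proof.
suff [[s sv] vE] : finsupport (comp^~ v) /\ v = \sum_(n \in [set: int]) comp n v.
  by exists (undup s); rewrite ?undup_uniq // {1}vE; apply: fsumE.
elim/gen_span: v => [|a x y [fx IHx] [fy IHy]|k x /gen_comp kx].
- split; first by exists [::] => i _; rewrite comp0.
  by rewrite (@fsum1 _ _ 0) ?comp0 // => i _; rewrite comp0.
- split; last first.
    rewrite {1}IHx {1}IHy -fsum_linearP //.
    by apply: eq_fsbigr => i _; rewrite comp_linear.
  case: fx fy => s sx [t ty]; exists (s ++ t) => i.
  rewrite mem_cat => /norP[si ti].
  by rewrite comp_linear sx // ty // scaler0 addr0.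
- split; first by exists [:: k] => i; rewrite inE kx => /negPf->.
  rewrite (@fsum1 _ _ k) ?kx ?eqxx // => i /negPf ik.
  by rewrite kx ik.
Qed.

End GradingFromGenerators.

Section TensorGrading.

Variables (K : fieldType) (U W : gradedType K).

(* (U ⊗ W)_n is the sum of the U_i ⊗ W_(n-i). Sums over all of int are finite
   here and below: a vector has finitely many nonzero components (gcomp_fin). *)
Definition tens_gcomp (n : int) : tens U W -> tens U W :=
  tlift (fun u w => \sum_(i \in [set: int]) (gcomp i u ⊗ gcomp (n - i) w)).

Lemma tens_gcomp_bilinear n : bilinear_for *:%R *:%R
  (fun (u : U) (w : W) => \sum_(i \in [set: int]) (gcomp i u ⊗ gcomp (n - i) w)).
Proof.
have fin u w : finsupport (fun i => gcomp i (u : U) ⊗ gcomp (n - i) (w : W)).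
  have [s su] := gcomp_fin u; exists s => i si.
  by rewrite su // linear0l.
split=> [w|u]; apply: fsum_linear => // i a x y; first by rewrite linearP linearPl.
by rewrite linearP linearPr.
Qed.

Lemma tens_gcomp_linear n : linear (tens_gcomp n).
Proof. exact/tlift_linear/tens_gcomp_bilinear. Qed.

Lemma tens_gcompE n (u : U) (w : W) :
  tens_gcomp n (u ⊗ w) = \sum_(i \in [set: int]) (gcomp i u ⊗ gcomp (n - i) w).
Proof. exact/tliftE/tens_gcomp_bilinear. Qed.

Definition tens_gen (k : int) (x : tens U W) : Prop :=
  exists i u w, [/\ homog i u, homog (k - i) w & x = u ⊗ w].

Lemma tens_gen_comp k n x :
  tens_gen k x -> tens_gcomp n x = if n == k then x else 0.
Proof.
case=> i [u [w [hu hw ->]]]; rewrite tens_gcompE (@fsum1 _ _ i); last first.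
  by move=> j /negPf ji; rewrite (homogE _ hu) ji linear0l.
rewrite (homogE _ hu) eqxx (homogE _ hw) (inj_eq (addIr _)).
by case: eqP; rewrite ?linear0r.
Qed.

Lemma tens_gen_span (P : tens U W -> Prop) :
  P 0 -> (forall a x y, P x -> P y -> P (a *: x + y)) ->
  (forall k x, tens_gen k x -> P x) -> forall x, P x.
Proof.
move=> P0 PD PG; apply: tens_ind => // u w.
have [s _ ->] := gcomp_sum u; have [t _ ->] := gcomp_sum w.
rewrite linear_sumlz; apply: span_sum => // i.
rewrite linear_sumr; apply: span_sum => // j.
apply: (PG (i + j)); exists i, (gcomp i u), (gcomp j w).
split; [exact: gcomp_homog| |exact: erefl].
have -> : i + j - i = j by rewrite addrAC subrr add0r.
exact: gcomp_homog.
Qed.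

HB.instance Definition _ := Lmodule_isGraded.Build K (tens U W)
  tens_gcomp_linear (gen_comp_comp tens_gcomp_linear tens_gen_comp tens_gen_span)
  (gen_comp_sum tens_gcomp_linear tens_gen_comp tens_gen_span).

End TensorGrading.

Section TcGrading.

Variables (K : fieldType) (V : gradedType K).

Definition lcons (v : V) : Tc V -> Tc V := Tclift (fun w => word (v :: w)).

Lemma lcons_multilinear v : multilinear (fun w => word (v :: w) : Tc V).
Proof. by move=> w1 a x y w2; rewrite -!cat_cons word_multilinear. Qed.

Lemma lconsE v w : lcons v (word w) = word (v :: w).
Proof. exact/TcliftE/lcons_multilinear. Qed.

Lemma lcons_linear v : linear (lcons v).
Proof. exact/Tclift_linear/lcons_multilinear. Qed.

Lemma lcons_bilinear : bilinear_for *:%R *:%R lcons.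
Proof.
split=> [t|v]; last exact: lcons_linear.
move=> a x y; rewrite /=; elim/Tc_ind: t => [|b t t' IH IH'|w].
- by rewrite !(linear_eq0 (@lcons_linear _)) scaler0 addr0.
- rewrite !lcons_linear IH IH' !scalerDr !scalerA (mulrC b) -!addrA.
  by congr (_ + _); rewrite addrCA.
- by rewrite !lconsE; apply: (word_multilinear [::]).
Qed.

HB.instance Definition _ :=
  bilinear_isBilinear.Build K V (Tc V) (Tc V) *:%R *:%R lcons lcons_bilinear.

(* The component of degree n of a word: the sum of all words of components
   (v1)_i1 ... (vk)_ik with i1 + ... + ik = n. *)
Fixpoint word_gcomp (n : int) (w : seq V) : Tc V :=
  if w is v :: w' then
    \sum_(i \in [set: int]) lcons (gcomp i v) (word_gcomp (n - i) w')
  else if n == 0 then word [::] else 0.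

Definition Tc_gcomp (n : int) : Tc V -> Tc V := Tclift (word_gcomp n).

Lemma word_gcomp_fin n (v : V) w :
  finsupport (fun i => lcons (gcomp i v) (word_gcomp (n - i) w)).
Proof.
by have [s sv] := gcomp_fin v; exists s => i /sv ->; rewrite linear0l.
Qed.

Lemma word_gcomp_multilinear n : multilinear (word_gcomp n).
Proof.
move=> w1 a x y w2; elim: w1 n => [|v w1 IH] n /=; last first.
  rewrite -fsum_linearP; [|exact: word_gcomp_fin|exact: word_gcomp_fin].
  by apply: eq_fsbigr => i _; rewrite IH linearPr.
rewrite -fsum_linearP; [|exact: word_gcomp_fin|exact: word_gcomp_fin].
by apply: eq_fsbigr => i _; rewrite linearP linearPl.
Qed.

Lemma Tc_gcomp_linear n : linear (Tc_gcomp n).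
Proof. exact/Tclift_linear/word_gcomp_multilinear. Qed.

Lemma Tc_gcompE n w : Tc_gcomp n (word w) = word_gcomp n w.
Proof. exact/TcliftE/word_gcomp_multilinear. Qed.

Inductive homword : int -> seq V -> Prop :=
| HomNil : homword 0 [::]
| HomCons i k v w : homog i v -> homword k w -> homword (i + k) (v :: w).

Lemma homword_rcons k w i v :
  homword k w -> homog i v -> homword (k + i) (rcons w v).
Proof.
move=> kw iv; elim: kw => [|j l u w' ju _ IH] /=; last first.
  by rewrite -addrA; constructor.
by rewrite addrC; constructor=> //; constructor.
Qed.

Definition Tc_gen (k : int) (x : Tc V) : Prop := exists2 w, homword k w & x = word w.

Lemma Tc_gen_comp k n x : Tc_gen k x -> Tc_gcomp n x = if n == k then x else 0.
Proof.
case=> w kw ->; rewrite Tc_gcompE.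
elim: kw n => [|i l v w' iv _ IH] n //=.
rewrite (@fsum1 _ _ i) => [|j /negPf ji]; last by rewrite (homogE _ iv) ji linear0l.
rewrite (homogE _ iv) eqxx IH subr_eq addrC.
by case: eqP => _; rewrite ?lconsE ?linear0r.
Qed.

Lemma Tc_gen_span (P : Tc V -> Prop) :
  P 0 -> (forall a x y, P x -> P y -> P (a *: x + y)) ->
  (forall k x, Tc_gen k x -> P x) -> forall x, P x.
Proof.
move=> P0 PD PG; apply: Tc_ind => // w.
suff H k w1 : homword k w1 -> P (word (w1 ++ w)) by apply: (H 0 [::]); constructor.
elim: w k w1 => [|v w IH] k w1 kw1; first by rewrite cats0; apply: (PG k); exists w1.
have [s _ ->] := gcomp_sum v; elim: s => [|i s IHs].
  rewrite big_nil; suff -> : word (w1 ++ 0 :: w) = 0 by [].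
  by apply: (@linear_eq0 K V _ (fun z => word (w1 ++ z :: w))) => a x y;
    apply: word_multilinear.
rewrite big_cons -[gcomp i v]scale1r word_multilinear; apply: PD => //.
rewrite -cat_rcons; apply: (IH (k + i)); apply: homword_rcons => //.
exact: gcomp_homog.
Qed.

HB.instance Definition _ := Lmodule_isGraded.Build K (Tc V)
  Tc_gcomp_linear (gen_comp_comp Tc_gcomp_linear Tc_gen_comp Tc_gen_span)
  (gen_comp_sum Tc_gcomp_linear Tc_gen_comp Tc_gen_span).

End TcGrading.

Section Koszul.

Variable K : fieldType.

(* v |-> (-1)^(e|v|) v *)
Definition koszul_sign (V : gradedType K) (e : int) (v : V) : V :=
  \sum_(n \in [set: int]) (-1) ^ (e * n) *: gcomp n v.

Lemma koszul_signE (V : gradedType K) e n (v : V) :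
  homog n v -> koszul_sign e v = (-1) ^ (e * n) *: v.
Proof.
move=> hv; rewrite /koszul_sign (@fsum1 _ _ n); first by rewrite hv.
by move=> i /negPf ni; rewrite (homogE _ hv) ni scaler0.
Qed.

Lemma koszul_sign_linear (V : gradedType K) e : linear (@koszul_sign V e).
Proof.
apply: fsum_linear => [i a x y|v].
  by rewrite linearP scalerDr !scalerA mulrC.
have [s sv] := gcomp_fin v.
by exists s => i /sv ->; rewrite scaler0.
Qed.

HB.instance Definition _ (V : gradedType K) e :=
  GRing.isLinear.Build K V V *:%R (@koszul_sign V e) (koszul_sign_linear e).

Section TensorMaps.
Variables (A : gradedType K) (B C D : lmodType K).

(* f ⊗ g for g homogeneous of degree e, with the sign rule
   (f ⊗ g)(a ⊗ b) = (-1)^(e|a|) f(a) ⊗ g(b). *)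
Definition tmap_deg (e : int) (f : A -> C) (g : B -> D) : tens A B -> tens C D :=
  tlift (fun a b => f (koszul_sign e a) ⊗ g b).

Variables (e : int) (f : {linear A -> C}) (g : {linear B -> D}).

Lemma tmap_deg_bilinear :
  bilinear_for *:%R *:%R (fun a b => f (koszul_sign e a) ⊗ g b).
Proof.
split=> [b|a] c x y; first by rewrite !linearP linearPl.
by rewrite linearP linearPr.
Qed.

Lemma tmap_degE n a b :
  homog n a -> tmap_deg e f g (a ⊗ b) = (-1) ^ (e * n) *: (f a ⊗ g b).
Proof.
move=> ha; rewrite /tmap_deg tliftE; last exact: tmap_deg_bilinear.
by rewrite (koszul_signE _ ha) linearZ linearZl_LR.
Qed.

Lemma tmap_deg_linear : linear (tmap_deg e f g).
Proof. exact/tlift_linear/tmap_deg_bilinear. Qed.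

HB.instance Definition _ :=
  GRing.isLinear.Build K _ _ *:%R (tmap_deg e f g) tmap_deg_linear.

End TensorMaps.

Section TensorMaps0.
Variables A B C D : lmodType K.

(* f ⊗ g for g of degree 0. *)
Definition tmap (f : A -> C) (g : B -> D) : tens A B -> tens C D :=
  tlift (fun a b => f a ⊗ g b).

Variables (f : {linear A -> C}) (g : {linear B -> D}).

Lemma tmap_bilinear : bilinear_for *:%R *:%R (fun a b => f a ⊗ g b).
Proof.
by split=> [b|a] c x y; rewrite linearP ?linearPl ?linearPr.
Qed.

Lemma tmapE a b : tmap f g (a ⊗ b) = f a ⊗ g b.
Proof. exact/tliftE/tmap_bilinear. Qed.

Lemma tmap_linear : linear (tmap f g).
Proof. exact/tlift_linear/tmap_bilinear. Qed.

HB.instance Definition _ :=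
  GRing.isLinear.Build K _ _ *:%R (tmap f g) tmap_linear.

End TensorMaps0.

Section Symmetry.
Variables A B : gradedType K.

(* a ⊗ b |-> (-1)^(|a||b|) b ⊗ a *)
Definition tswap : tens A B -> tens B A :=
  tlift (fun a b => \sum_(n \in [set: int]) (koszul_sign n b ⊗ gcomp n a)).

Lemma tswap_bilinear : bilinear_for *:%R *:%R
  (fun (a : A) (b : B) =>
     \sum_(n \in [set: int]) (koszul_sign n b ⊗ gcomp n a)).
Proof.
have fin (a : A) (b : B) : finsupport (fun n => koszul_sign n b ⊗ gcomp n a).
  by have [s sa] := gcomp_fin a; exists s => i /sa ->; rewrite linear0r.
split=> [b|a]; apply: fsum_linear => // i c x y.
  by rewrite linearP linearPr.
by rewrite linearP linearPl.
Qed.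

Lemma tswapE m n (a : A) (b : B) :
  homog m a -> homog n b -> tswap (a ⊗ b) = (-1) ^ (m * n) *: (b ⊗ a).
Proof.
move=> ha hb; rewrite /tswap tliftE; last exact: tswap_bilinear.
rewrite (@fsum1 _ _ m) => [|i /negPf im]; last first.
  by rewrite (homogE _ ha) im linear0r.
by rewrite ha (koszul_signE _ hb) linearZl_LR.
Qed.

Lemma tswap_linear : linear tswap.
Proof. exact/tlift_linear/tswap_bilinear. Qed.

HB.instance Definition _ := GRing.isLinear.Build K _ _ *:%R tswap tswap_linear.

End Symmetry.

Lemma tlift_param (Z U W X : lmodType K) (f : Z -> U -> W -> X) t :
  (forall z, bilinear_for *:%R *:%R (f z)) ->
  (forall u w, linear (fun z => f z u w)) -> linear (fun z => tlift (f z) t).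
Proof.
move=> bf lf a x y; elim/tens_ind: t => [|b s t IHs IHt|u w].
- by rewrite !(linear_eq0 (tlift_linear (bf _))) scaler0 addr0.
- rewrite !(tlift_linear (bf _)) IHs IHt !scalerDr !scalerA (mulrC b) -!addrA.
  by congr (_ + _); rewrite addrCA.
- by rewrite !tliftE //; apply: lf.
Qed.

Section Middle.
Variables A B C D : gradedType K.

Let tmid4 (a : A) (d : D) (c : C) (b : B) : tens (tens A C) (tens B D) :=
  (a ⊗ c) ⊗ (b ⊗ d).

(* id ⊗ tswap ⊗ id on (A ⊗ B) ⊗ (C ⊗ D) *)
Definition tmiddle : tens (tens A B) (tens C D) -> tens (tens A C) (tens B D) :=
  tlift (fun p q => tlift (fun a b => tlift (fun c d =>
    tlift (fun c' b' => (a ⊗ c') ⊗ (b' ⊗ d)) (tswap (b ⊗ c))) q) p).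

Let bl4 a d : bilinear_for *:%R *:%R (tmid4 a d).
Proof.
split=> [b|c] k x y; rewrite /tmid4; first by rewrite linearPr linearPl.
by rewrite linearPl linearPr.
Qed.

Let la4 d t : linear (fun a => tlift (tmid4 a d) t).
Proof.
apply: tlift_param => [a|c b] //; move=> k x y.
by rewrite /tmid4 !linearPl.
Qed.

Let ld4 a t : linear (fun d => tlift (tmid4 a d) t).
Proof.
apply: tlift_param => [d|c b] //; move=> k x y.
by rewrite /tmid4 !linearPr.
Qed.

Let mid2 (a : A) (b : B) (c : C) (d : D) := tlift (tmid4 a d) (tswap (b ⊗ c)).

Let bl2 a b : bilinear_for *:%R *:%R (mid2 a b).
Proof.
split=> [d|c]; last exact: ld4.
by move=> k x y; rewrite /mid2 linearPr linearP (tlift_linear (bl4 _ _)).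
Qed.

Let bl1 q : bilinear_for *:%R *:%R (fun a b => tlift (mid2 a b) q).
Proof.
split=> [b|a]; apply: tlift_param => // c d; first exact: la4.
by move=> k x y; rewrite /mid2 linearPl linearP (tlift_linear (bl4 _ _)).
Qed.

Let bl0 : bilinear_for *:%R *:%R
  (fun p q => tlift (fun a b => tlift (mid2 a b) q) p).
Proof.
split=> [q|p]; first exact: tlift_linear.
by apply: tlift_param => // a b; exact/tlift_linear/bl2.
Qed.

Lemma tmiddle_linear : linear tmiddle.
Proof. exact: (tlift_linear bl0). Qed.

HB.instance Definition _ :=
  GRing.isLinear.Build K _ _ *:%R tmiddle tmiddle_linear.

Lemma tmiddleE m n a (b : B) (c : C) d : homog m b -> homog n c ->
  tmiddle ((a ⊗ b) ⊗ (c ⊗ d)) = (-1) ^ (m * n) *: ((a ⊗ c) ⊗ (b ⊗ d)).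
Proof.
move=> hb hc; rewrite /tmiddle (tliftE bl0) (tliftE (bl1 _)) (tliftE (bl2 _ _)).
rewrite /mid2 (tswapE hb hc) -[_ *: (c ⊗ b)]addr0.
rewrite (tlift_linear (bl4 a d)) (linear_eq0 (tlift_linear (bl4 a d))) addr0.
by rewrite (tliftE (bl4 a d)).
Qed.

End Middle.

End Koszul.

Section TensorCoalgebra.

Variables (K : fieldType) (V : lmodType K).

Definition deconc (w : seq V) : tens (Tc V) (Tc V) :=
  \sum_(i < (size w).+1) (word (take i w) ⊗ word (drop i w)).

Lemma deconc_multilinear : multilinear deconc.
Proof.
move=> w1 a x y w2; rewrite /deconc.
have sz z : size (w1 ++ z :: w2) = (size w1 + (size w2).+1)%N by rewrite size_cat.
rewrite !sz scaler_sumr -big_split; apply: eq_bigr => i _ /=.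
rewrite !take_cat !drop_cat; case: ltnP => _.
  by rewrite word_multilinear linearPr.
case: (i - size w1)%N => [|k] /=; first by rewrite !(word_multilinear [::]) linearPr.
by rewrite word_multilinear linearPl.
Qed.

(* The letter of a word of length 1, and 0 on the other words. *)
Definition letter_of (w : seq V) : V := if w is [:: v] then v else 0.

Lemma letter_of_multilinear : multilinear letter_of.
Proof.
case=> [|v [|v' w1]] a x y [|v2 w2] //=; by rewrite ?scaler0 ?addr0.
Qed.

Definition trunc_word (k : nat) (w : seq V) : Tc V :=
  if size w == k then word w else 0.

Lemma trunc_word_multilinear k : multilinear (trunc_word k).
Proof.
move=> w1 a x y w2; rewrite /trunc_word !size_cat /=.
by case: eqP => _; [apply: word_multilinear | rewrite scaler0 addr0].
Qed.

Definition empty_coef (w : seq V) : K^o := (w == [::])%:R.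

Lemma empty_coef_multilinear : multilinear empty_coef.
Proof. by case=> [|v w1] a x y w2; rewrite /empty_coef /= scaler0 addr0. Qed.

Definition Tcomult : Tc V -> tens (Tc V) (Tc V) := Tclift deconc.
Definition Tcounit : Tc V -> K^o := Tclift empty_coef.
Definition Tproj1 : Tc V -> V := Tclift letter_of.
Definition Tlen (k : nat) : Tc V -> Tc V := Tclift (trunc_word k).
Definition Tone : Tc V := word [::].

HB.instance Definition _ := GRing.isLinear.Build K _ _ *:%R Tcomult
  (Tclift_linear deconc_multilinear).
HB.instance Definition _ := GRing.isLinear.Build K _ _ *:%R Tcounit
  (Tclift_linear empty_coef_multilinear).
HB.instance Definition _ := GRing.isLinear.Build K _ _ *:%R Tproj1
  (Tclift_linear letter_of_multilinear).
HB.instance Definition _ k := GRing.isLinear.Build K _ _ *:%R (Tlen k)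
  (Tclift_linear (trunc_word_multilinear k)).

Lemma TcomultE w :
  Tcomult (word w) = \sum_(i < (size w).+1) (word (take i w) ⊗ word (drop i w)).
Proof. exact: (TcliftE deconc_multilinear). Qed.
Lemma TcounitE w : Tcounit (word w) = (w == [::])%:R.
Proof. exact: (TcliftE empty_coef_multilinear). Qed.
Lemma Tproj1E w : Tproj1 (word w) = if w is [:: v] then v else 0.
Proof. exact: (TcliftE letter_of_multilinear). Qed.
Lemma TlenE k w : Tlen k (word w) = if size w == k then word w else 0.
Proof. exact: (TcliftE (trunc_word_multilinear k)). Qed.

(* The sum of the V^{⊗k} over k >= 1. *)
Definition Tbar : {pred Tc V} := fun x => Tlen 0 x == 0.

(* V^{⊗k}, as a submodule of T^c(V). *)
Definition in_tpow (k : nat) : {pred Tc V} := fun x => Tlen k x == x.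

Lemma in_tpow_closed k : submod_closed (in_tpow k).
Proof.
split=> [|a x y /eqP xk /eqP yk]; apply/eqP; first exact: linear0.
by rewrite linearP /= xk yk.
Qed.

HB.instance Definition _ k :=
  GRing.isSubmodClosed.Build K (Tc V) (in_tpow k) (in_tpow_closed k).

Record tpow (k : nat) : Type := TPow { tpow_val : Tc V; _ : tpow_val \in in_tpow k }.
HB.instance Definition _ k := [isSub for @tpow_val k].
HB.instance Definition _ k := [Choice of tpow k by <:].
HB.instance Definition _ k := [SubChoice_isSubLmodule of tpow k by <:].

Lemma tpow_word_subproof k (w : k.-tuple V) : word w \in in_tpow k.
Proof. by apply/eqP; rewrite TlenE size_tuple eqxx. Qed.

Definition tpow_word k (w : k.-tuple V) : tpow k := TPow (tpow_word_subproof w).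

(* The identifications of K with V^{⊗0} and of V with V^{⊗1}. *)
Definition tpow0 (c : K) : tpow 0 := c *: tpow_word [tuple].
Definition tpow1 (v : V) : tpow 1 := tpow_word [tuple v].

Lemma tpow0_bij : bijective tpow0.
Proof.
have valE c : tpow_val (tpow0 c) = c *: word [::].
  by rewrite /tpow0 -[LHS]/(val _) linearZ.
exists (fun x => Tcounit (tpow_val x)) => [c|x].
  by rewrite valE linearZ /= TcounitE eqxx; apply: mulr1.
apply: val_inj; rewrite [LHS]valE; case: x => x /= /eqP {2}<-.
elim/Tc_ind: x => [|a x y IHx IHy|w].
- by rewrite !linear0 scale0r.
- by rewrite !linearP /= -IHx -IHy scalerDl scalerA.
- by rewrite TlenE TcounitE; case: w => [|v w]; rewrite ?scale1r ?scale0r.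
Qed.

Lemma tpow1_bij : bijective tpow1.
Proof.
exists (fun x => Tproj1 (tpow_val x)) => [v|x]; first by rewrite /= Tproj1E.
apply: val_inj; case: x => x /= /eqP {2}<-.
have w1 : linear (fun v : V => word [:: v]) by move=> a y z; apply: (word_multilinear [::]).
elim/Tc_ind: x => [|a x y IHx IHy|w].
- by rewrite !linear0 (linear_eq0 w1).
- by rewrite !linearP /= w1 IHx IHy.
- rewrite TlenE Tproj1E; case: w => [|v [|v' w]] //=; exact: (linear_eq0 w1).
Qed.

End TensorCoalgebra.

Arguments Tone {K V}.
Arguments tpow {K} V k.

(* T^c(V) ⊗ T^c(V) is a coalgebra under (id ⊗ swap ⊗ id)(Δ ⊗ Δ) and ε ⊗ ε. *)
Definition TTcomult (K : fieldType) (V : gradedType K) (z : tens (Tc V) (Tc V)) :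
    tens (tens (Tc V) (Tc V)) (tens (Tc V) (Tc V)) :=
  tmiddle (tmap (@Tcomult K V) (@Tcomult K V) z).
Definition TTcounit (K : fieldType) (V : gradedType K) :
    tens (Tc V) (Tc V) -> K^o := tlift (fun x y => Tcounit x * Tcounit y).

Lemma TTcounitE (K : fieldType) (V : gradedType K) (x y : Tc V) :
  TTcounit (x ⊗ y) = Tcounit x * Tcounit y.
Proof.
apply: tliftE; split=> [w|u] a s t; first by rewrite linearP mulrDl -scalerAl.
by rewrite linearP mulrDr -scalerAr.
Qed.

(* Not an algType: that would exclude V = 0, where the unit is 0. *)
Record dgAlgebra (K : fieldType) (V : gradedType K) := DgAlgebra {
  dg_mul : {bilinear V -> V -> V};
  dg_one : V;
  dg_diff : {linear V -> V};
  dg_mul_degree : forall m n a b,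
    homog m a -> homog n b -> homog (m + n) (dg_mul a b);
  dg_mulA : associative dg_mul;
  dg_one_degree : homog 0 dg_one;
  dg_mul1l : left_id dg_one dg_mul;
  dg_mul1r : right_id dg_one dg_mul;
  dg_diff_degree : has_degree (-1) dg_diff;
  dg_diff2 : forall a, dg_diff (dg_diff a) = 0;
  dg_leibniz : forall n a b, homog n a ->
    dg_diff (dg_mul a b) =
      dg_mul (dg_diff a) b + (-1) ^ n *: dg_mul a (dg_diff b)
}.

Record Binfty (K : fieldType) (V : gradedType K) := BInfty {
  Bmu : {linear tens (Tc V) (Tc V) -> Tc V};
  Bd : {linear Tc V -> Tc V};
  Bmu_degree : has_degree 0 Bmu;
  Bmu_comult : forall z, Tcomult (Bmu z) = tmap Bmu Bmu (TTcomult z);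
  Bmu_counit : forall z, Tcounit (Bmu z) = TTcounit z;
  BmuA : forall x y z, Bmu (x ⊗ Bmu (y ⊗ z)) = Bmu (Bmu (x ⊗ y) ⊗ z);
  Bmu1l : forall x, Bmu (Tone ⊗ x) = x;
  Bmu1r : forall x, Bmu (x ⊗ Tone) = x;
  Bd_degree : has_degree (-1) Bd;
  Bd_coder : forall x, Tcomult (Bd x) =
    tmap Bd idfun (Tcomult x) + tmap_deg (-1) idfun Bd (Tcomult x);
  Bd1 : Bd Tone = 0;
  Bd2 : forall x, Bd (Bd x) = 0;
  Bd_mu : forall z, Bd (Bmu z) = Bmu (tmap Bd idfun z + tmap_deg (-1) idfun Bd z)
}.

Section Operations.

Variables (K : fieldType) (V : gradedType K) (B : Binfty V).

Definition Bop1 (n : nat) (x : tpow V n) : V := Tproj1 (Bd B (val x)).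

Definition Bop2 (i j : nat) (z : tens (tpow V i) (tpow V j)) : V :=
  Tproj1 (Bmu B (tmap val val z)).

End Operations.

(* p1 o mu = mul o (p1 ⊗ p1) on Tbar ⊗ Tbar and p1 o d = diff o p1 on Tbar. *)
Definition Binduced (K : fieldType) (V : gradedType K) (A : dgAlgebra V)
    (B : Binfty V) : Prop :=
  (forall x y, x \in @Tbar K V -> y \in @Tbar K V ->
     Tproj1 (Bmu B (x ⊗ y)) = dg_mul A (Tproj1 x) (Tproj1 y)) /\
  (forall x, x \in @Tbar K V -> Tproj1 (Bd B x) = dg_diff A (Tproj1 x)).

(* Main.v *)
Require Import Defs.
From HB Require Import structures.
From mathcomp Require Import all_boot ssralg ssrint sesquilinear.
From mathcomp Require Import ring zify.

Import GRing.Theory.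

Local Open Scope ring_scope.

Set Implicit Arguments.
Unset Strict Implicit.
Unset Printing Implicit Defensive.

(** A tensor is the sum of its scalar part and of its first letters put back in
    front of what follows them: t = eps(t) 1 + sum p1(t') t'', the sum running
    over the coproduct of t (peel_Tcomult).  Applied to t = mu(z), for a map mu
    of coalgebras, this gives
      mu(z) = eps(z) 1 + sum p1(mu(z')) mu(z''),
    where z' and z'' come from the coproduct of T^c(V) (x) T^c(V), with the
    Koszul signs of its middle exchange.  If p1 o mu vanishes on 1 (x) 1, only
    terms with z'' shorter than z contribute, so that mu is determined by
    p1 o mu, by induction on the total length of the words in z.

    Unitality and the prescribed value on reduced tensors force
      p1(mu(s (x) t)) = eps(s) p1(t) + eps(t) p1(s) + p1(s) . p1(t)
    (qsproj_pair).  Read as a definition, the recursion then constructs mu, the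
    quasi-shuffle product qsmul: a word in the product of x and y begins with the
    first letter of x, the first letter of y, or their product.  The differential
    is the coderivation bardiff, which applies the differential of V to one letter
    at a time.

    The main laws equate two maps obeying a recursion of the above shape, so that
    each reduces to comparing first letters.  For associativity this is
    the associativity of the product of V (qsprojA); for the compatibility of
    d with mu it is the Leibniz rule (qsproj_tensdiff); comultiplicativity of
    mu amounts to the coassociativity of deconcatenation (splits_coassoc).
    Uniqueness is the same induction, run for an arbitrary structure with the
    prescribed first letters (Binduced_mul, Binduced_diff_rec), and the
    operations are read off from qsproj_pair.

    Everything is checked on words whose letters are homogeneous, where each
    sign is an explicit power of -1. *)

(** * Signs and linearity *)

(** Only the parity of the exponent matters; stated with [k + k] so that [ring]
    can check a comparison of Koszul signs once [k] is supplied. *)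
Lemma signz_eq (K : fieldType) (k m n : int) :
  m = n + k + k -> (-1) ^ m = (-1) ^ n :> K.
Proof.
move=> ->; rewrite !expfzDr ?oppr_eq0 ?oner_eq0 // -mulrA -expfzMl.
by rewrite mulrNN mulr1 exp1rz mulr1.
Qed.

Lemma signzD (K : fieldType) (m n : int) :
  (-1) ^ (m + n) = (-1) ^ m * (-1) ^ n :> K.
Proof. by rewrite expfzDr ?oppr_eq0 ?oner_eq0. Qed.

(** The maps below are built by composing and lifting functions, so linearity is
    carried as a plain proposition rather than as a bundled structure. *)
Lemma comp_linear (K : fieldType) (U W X : lmodType K) (f : W -> X) (g : U -> W) :
  linear f -> linear g -> linear (fun u => f (g u)).
Proof. by move=> lf lg a x y; rewrite lg lf. Qed.

Lemma add_linear (K : fieldType) (U W : lmodType K) (f g : U -> W) :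
  linear f -> linear g -> linear (fun u => f u + g u).
Proof. by move=> lf lg a x y; rewrite lf lg scalerDr addrACA. Qed.

Lemma scale_linear (K : fieldType) (U W : lmodType K) (f : U -> K^o) (w : W) :
  linear f -> linear (fun u => (f u : K) *: w).
Proof. by move=> lf a x y; rewrite lf scalerDl -scalerA. Qed.

Lemma linear_D (K : fieldType) (U W : lmodType K) (f : U -> W) :
  linear f -> {morph f : u v / u + v}.
Proof. by move=> lf u v; rewrite -[u in LHS]scale1r lf scale1r. Qed.

Lemma linear_Z (K : fieldType) (U W : lmodType K) (f : U -> W) :
  linear f -> forall c u, f (c *: u) = c *: f u.
Proof. by move=> lf c u; rewrite -[c *: u]addr0 lf (linear_eq0 lf) addr0. Qed.

Lemma comp_bilinear (K : fieldType) (U W X Y : lmodType K)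
    (g : X -> Y) (f : U -> W -> X) :
  linear g -> bilinear_for *:%R *:%R f ->
  bilinear_for *:%R *:%R (fun u w => g (f u w)).
Proof.
move=> lg [fl fr]; split=> [w|u] c x y; first by rewrite /= fl lg.
by rewrite /= fr lg.
Qed.

Lemma add_bilinear (K : fieldType) (U W X : lmodType K) (f g : U -> W -> X) :
  bilinear_for *:%R *:%R f -> bilinear_for *:%R *:%R g ->
  bilinear_for *:%R *:%R (fun u w => f u w + g u w).
Proof.
move=> [fl fr] [gl gr].
by split=> [w|u]; apply: add_linear; [exact: fl|exact: gl|exact: fr|exact: gr].
Qed.

Lemma linear_bigsum (K : fieldType) (U W : lmodType K) (f : U -> W) :
  linear f -> forall I (r : seq I) F,
  f (\sum_(i <- r) F i) = \sum_(i <- r) f (F i).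
Proof.
move=> lf I r F; elim: r => [|i r IH]; first by rewrite !big_nil (linear_eq0 lf).
by rewrite !big_cons -IH -[F i]scale1r lf !scale1r.
Qed.

Lemma bilinear_sum2 (K : fieldType) (U W X : lmodType K) (f : U -> W -> X) :
  bilinear_for *:%R *:%R f -> forall I J (r : seq I) (r' : seq J) F G,
  f (\sum_(i <- r) F i) (\sum_(j <- r') G j) =
    \sum_(i <- r) \sum_(j <- r') f (F i) (G j).
Proof.
move=> [fl fr] I J r r' F G.
rewrite (linear_bigsum (f := f^~ _)); last exact: fl.
by apply: eq_bigr => i _; rewrite (linear_bigsum (f := f _)) //; apply: fr.
Qed.

(** * Cutting a sequence in two *)

Section Splits.

Variable T : Type.
Implicit Types (a : T) (s u v : seq T).

(** Deconcatenation as a list of pairs, which lets coassociativity and the counit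
    laws be proved for sums in any module, without tensors. *)
Fixpoint splits s : seq (seq T * seq T) :=
  ([::], s) ::
    (if s is a :: s' then [seq (a :: p.1, p.2) | p <- splits s'] else [::]).

Variable M : nmodType.
Implicit Types F G : seq T * seq T -> M.

Lemma big_splits_nil F : \sum_(p <- splits [::]) F p = F ([::], [::]).
Proof. exact: big_seq1. Qed.

Lemma big_splits_cons F a s :
  \sum_(p <- splits (a :: s)) F p =
    F ([::], a :: s) + \sum_(p <- splits s) F (a :: p.1, p.2).
Proof. by rewrite big_cons big_map. Qed.

Lemma eq_big_splits F G s : (forall u v, s = u ++ v -> F (u, v) = G (u, v)) ->
  \sum_(p <- splits s) F p = \sum_(p <- splits s) G p.
Proof.
elim: s F G => [|a s IH] F G FG; first by rewrite !big_splits_nil FG.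
rewrite !big_splits_cons FG //; congr (_ + _).
by apply: IH => u v s_uv; rewrite FG // s_uv.
Qed.

Lemma big_splits_left F s : (forall a u v, s = a :: u ++ v -> F (a :: u, v) = 0) ->
  \sum_(p <- splits s) F p = F ([::], s).
Proof.
case: s => [|a s] F0; first exact: big_splits_nil.
rewrite big_splits_cons (eq_big_splits (G := fun=> 0)) ?big1 ?addr0 // => u v suv.
by rewrite F0 // suv.
Qed.

Lemma big_splits_right F s :
  (forall u a v, s = u ++ a :: v -> F (u, a :: v) = 0) ->
  \sum_(p <- splits s) F p = F (s, [::]).
Proof.
elim: s F => [|a s IH] F F0; first exact: big_splits_nil.
rewrite big_splits_cons (F0 [::]) // add0r IH // => u b v suv.
by rewrite F0 // suv.
Qed.

(** Both sides run over the ways to cut [s] into three consecutive pieces. *)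
Lemma splits_coassoc (F : seq T -> seq T -> seq T -> M) s :
  \sum_(p <- splits s) \sum_(q <- splits p.2) F p.1 q.1 q.2 =
    \sum_(p <- splits s) \sum_(q <- splits p.1) F q.1 q.2 p.2.
Proof.
elim: s F => [|a s IH] F; first by rewrite !big_splits_nil.
rewrite !big_splits_cons /= big_splits_nil (IH (fun u => F (a :: u))) -addrA.
congr (_ + _).
by rewrite -big_split; apply: eq_bigr => p _; rewrite big_splits_cons.
Qed.

Lemma big_splits_take_drop F s :
  \sum_(i < (size s).+1) F (take i s, drop i s) = \sum_(p <- splits s) F p.
Proof.
elim: s F => [|a s IH] F; first by rewrite big_splits_nil big_ord1.
by rewrite big_splits_cons big_ord_recl -IH.
Qed.

End Splits.

Lemma splits_coassoc2 (T T' : Type) (M : nmodType)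
    (F : seq T -> seq T -> seq T -> seq T' -> seq T' -> seq T' -> M) x y :
  \sum_(p <- splits x) \sum_(q <- splits y)
    \sum_(p' <- splits p.2) \sum_(q' <- splits q.2)
      F p.1 p'.1 p'.2 q.1 q'.1 q'.2 =
  \sum_(p <- splits x) \sum_(q <- splits y)
    \sum_(p' <- splits p.1) \sum_(q' <- splits q.1)
      F p'.1 p'.2 p.2 q'.1 q'.2 q.2.
Proof.
under eq_bigr => p _ do rewrite exchange_big.
under [RHS]eq_bigr => p _ do rewrite exchange_big.
rewrite (splits_coassoc (fun u v w => \sum_(q <- splits y) \sum_(q' <- splits q.2)
  F u v w q.1 q'.1 q'.2)).
apply: eq_bigr => p _; apply: eq_bigr => p' _; exact: splits_coassoc.
Qed.

(** * Homogeneous words *)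

(** The degree is recorded because it is not determined by the vector: 0 is
    homogeneous of every degree, and the signs of a word must be definite. *)
Record hletter (K : fieldType) (V : gradedType K) := HLetter {
  hdeg : int;
  hval :> V;
  hvalP : homog hdeg hval
}.

Lemma Tcounit_linear (K : fieldType) (V : lmodType K) : linear (@Tcounit K V).
Proof. exact: linearP. Qed.

Lemma Tproj1_linear (K : fieldType) (V : lmodType K) : linear (@Tproj1 K V).
Proof. exact: linearP. Qed.

Lemma Tcomult_linear (K : fieldType) (V : lmodType K) : linear (@Tcomult K V).
Proof. exact: linearP. Qed.

Arguments Tcounit_linear {K V}.
Arguments Tproj1_linear {K V}.
Arguments Tcomult_linear {K V}.

Section HomogeneousWords.

Variables (K : fieldType) (V : gradedType K).
Implicit Types (a b : hletter V) (x y z : seq (hletter V)).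

Definition wdeg x : int := foldr (fun a n => hdeg a + n) 0 x.

Definition hword x : Tc V := word (map (@hval K V) x).

Lemma wdeg_cat x y : wdeg (x ++ y) = wdeg x + wdeg y.
Proof. by elim: x => [|a x IH] /=; rewrite ?add0r // IH addrA. Qed.

(** Every vector is a finite sum of homogeneous ones, so words with homogeneous
    letters span. *)
Lemma hword_ind (P : Tc V -> Prop) :
  P 0 -> (forall c s t, P s -> P t -> P (c *: s + t)) ->
  (forall x, P (hword x)) -> forall t, P t.
Proof.
move=> P0 PD Pw; apply: Tc_gen_span => // k _ [w kw ->].
suff [x ->] : exists x, w = map (@hval K V) x by apply: Pw.
elim: kw => [|i j v u iv _ [x ->]]; first by exists [::].
by exists (HLetter iv :: x).
Qed.

Lemma hword2_ind (P : tens (Tc V) (Tc V) -> Prop) :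
  P 0 -> (forall c s t, P s -> P t -> P (c *: s + t)) ->
  (forall x y, P (hword x ⊗ hword y)) -> forall t, P t.
Proof.
move=> P0 PD Pw; apply: tens_ind => // s t.
elim/hword_ind: s => [|c s s' IHs IHs'|x]; first by rewrite linear0l.
  by rewrite linearPl; apply: PD.
elim/hword_ind: t => [|c t t' IHt IHt'|y] //; first by rewrite linear0r.
by rewrite linearPr; apply: PD.
Qed.

Lemma linear_eq_hword (M : lmodType K) (f g : Tc V -> M) :
  linear f -> linear g -> (forall x, f (hword x) = g (hword x)) -> f =1 g.
Proof.
move=> lf lg fg; elim/hword_ind => [|c s t IHs IHt|//].
  by rewrite (linear_eq0 lf) (linear_eq0 lg).
by rewrite lf lg IHs IHt.
Qed.

Lemma linear_eq_hword2 (M : lmodType K) (f g : tens (Tc V) (Tc V) -> M) :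
  linear f -> linear g ->
  (forall x y, f (hword x ⊗ hword y) = g (hword x ⊗ hword y)) -> f =1 g.
Proof.
move=> lf lg fg; elim/hword2_ind => [|c s t IHs IHt|//].
  by rewrite (linear_eq0 lf) (linear_eq0 lg).
by rewrite lf lg IHs IHt.
Qed.

Lemma homogD (U : gradedType K) n (u v : U) :
  homog n u -> homog n v -> homog n (u + v).
Proof. by move=> hu hv; rewrite /homog linearD /= hu hv. Qed.

Lemma homogZ (U : gradedType K) n c (u : U) : homog n u -> homog n (c *: u).
Proof. by move=> hu; rewrite /homog linearZ /= hu. Qed.

Lemma homog0 (U : gradedType K) n : homog n (0 : U).
Proof. exact: linear0. Qed.

Lemma homog_tpure (U W : gradedType K) m n (u : U) (w : W) :
  homog m u -> homog n w -> homog (m + n) (u ⊗ w).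
Proof.
move=> hu hw; rewrite /homog /gcomp /= (@tens_gen_comp _ _ _ (m + n)) ?eqxx //.
by exists m, u, w; split=> //; rewrite addrC addKr.
Qed.

Lemma homog_hword x : homog (wdeg x) (hword x).
Proof.
suff hx : homword (wdeg x) (map (@hval K V) x).
  by rewrite /homog /gcomp /= (@Tc_gen_comp _ _ (wdeg x)) ?eqxx //;
    exists (map (@hval K V) x).
by elim: x => [|a x IH] /=; constructor=> //; apply: hvalP.
Qed.

Lemma lcons_hword a x : lcons a (hword x) = hword (a :: x).
Proof. exact: lconsE. Qed.

Lemma homog_lcons i k (v : V) t :
  homog i v -> homog k t -> homog (i + k) (lcons v t).
Proof.
move=> iv kt; rewrite /homog.
suff -> : gcomp (i + k) (lcons v t) = lcons v (gcomp k t).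
  by rewrite kt.
move: t {kt}; apply: linear_eq_hword => [c s t|c s t|x].
- by rewrite linearPr linearP.
- by rewrite linearP linearPr.
- have hx : homog (i + wdeg x) (lcons v (hword x)).
    by have := homog_hword (HLetter iv :: x); rewrite -lcons_hword.
  rewrite (homogE _ hx) (homogE _ (homog_hword x)) (inj_eq (addrI i)).
  by case: eqP; rewrite ?linear0r.
Qed.

Lemma has_degree_hword (U : gradedType K) k (f : {linear Tc V -> U}) :
  (forall x, homog (wdeg x + k) (f (hword x))) -> has_degree k f.
Proof.
move=> fk n t nt; rewrite /homog.
suff -> : gcomp (n + k) (f t) = f (gcomp n t) by rewrite nt.
move: t {nt}; apply: linear_eq_hword => [c s t|c s t|x].
- by rewrite !linearP.
- by rewrite !linearP.
- rewrite (homogE _ (fk x)) (homogE _ (homog_hword x)) (inj_eq (addIr k)).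
  by case: eqP; rewrite ?linear0.
Qed.

Lemma has_degree_hword2 (U : gradedType K) k (f : {linear tens (Tc V) (Tc V) -> U}) :
  (forall x y, homog (wdeg x + wdeg y + k) (f (hword x ⊗ hword y))) ->
  has_degree k f.
Proof.
move=> fk n t nt; rewrite /homog.
suff -> : gcomp (n + k) (f t) = f (gcomp n t) by rewrite nt.
move: t {nt}; apply: linear_eq_hword2 => [c s t|c s t|x y].
- by rewrite !linearP.
- by rewrite !linearP.
- have hxy := homog_tpure (homog_hword x) (homog_hword y).
  rewrite (homogE _ (fk x y)) (homogE _ hxy) (inj_eq (addIr k)).
  by case: eqP; rewrite ?linear0.
Qed.

Lemma Tcomult_hword x :
  Tcomult (hword x) = \sum_(p <- splits x) (hword p.1 ⊗ hword p.2).
Proof.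
rewrite TcomultE size_map -big_splits_take_drop.
by apply: eq_bigr => i _; rewrite /hword map_take map_drop.
Qed.

Section MiddleSwap.

Variables (M : lmodType K)
  (L : tens (tens (Tc V) (Tc V)) (tens (Tc V) (Tc V)) -> M).
Hypothesis lL : linear L.

(** The coproduct of T^c(V) (x) T^c(V), followed by a linear map [L], as a bilinear
    function of the two separate coproducts.  With values in an arbitrary module
    the expansion on sums takes place there, not in a fourfold tensor product. *)
Definition midswap (s t : tens (Tc V) (Tc V)) : M := L (tmiddle (s ⊗ t)).

Lemma midswap_bilinear : bilinear_for *:%R *:%R midswap.
Proof.
exact: (comp_bilinear
  (comp_linear lL (@tmiddle_linear K (Tc V) (Tc V) (Tc V) (Tc V)))
  (@tpure_bilinear K _ _)).
Qed.

Lemma midswapE m n (s1 s2 t1 t2 : Tc V) : homog m s2 -> homog n t1 ->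
  midswap (s1 ⊗ s2) (t1 ⊗ t2) =
    (-1) ^ (m * n) *: L ((s1 ⊗ t1) ⊗ (s2 ⊗ t2)).
Proof.
move=> ms nt.
have mE := @tmiddleE K (Tc V) (Tc V) (Tc V) (Tc V) _ _ s1 _ _ t2 ms nt.
exact: etrans (congr1 L mE) (linear_Z lL _ _).
Qed.

Lemma midswap_comult s t :
  midswap (Tcomult s) (Tcomult t) = L (TTcomult (s ⊗ t)).
Proof. by rewrite /TTcomult tmapE. Qed.

Lemma TTcomult_hword x y :
  L (TTcomult (hword x ⊗ hword y)) =
    \sum_(p <- splits x) \sum_(q <- splits y) (-1) ^ (wdeg p.2 * wdeg q.1) *:
      L ((hword p.1 ⊗ hword q.1) ⊗ (hword p.2 ⊗ hword q.2)).
Proof.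
rewrite -midswap_comult !Tcomult_hword (bilinear_sum2 midswap_bilinear).
apply: eq_bigr => p _; apply: eq_bigr => q _.
exact: midswapE (homog_hword _) (homog_hword _).
Qed.

End MiddleSwap.

Lemma Tcounit_hword x : Tcounit (hword x) = (nilp x)%:R.
Proof. by rewrite TcounitE; case: x. Qed.

Lemma Tproj1_hword x : Tproj1 (hword x) = if x is [:: a] then hval a else 0.
Proof. by rewrite Tproj1E; case: x => [|a []]. Qed.

Lemma Tcounit_lcons (v : V) t : Tcounit (lcons v t) = 0.
Proof.
move: t; apply: linear_eq_hword => [c s t|c s t|x].
- by rewrite linearPr linearP.
- by rewrite scaler0 addr0.
- by rewrite lconsE TcounitE.
Qed.

Lemma Tproj1_lcons (v : V) t : Tproj1 (lcons v t) = (Tcounit t : K) *: v.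
Proof.
move: t; apply: linear_eq_hword => [c s t|c s t|x].
- by rewrite linearPr linearP.
- by rewrite linearP scalerDl scalerA.
- by rewrite lconsE Tproj1E Tcounit_hword; case: x => [|a x] /=;
    rewrite ?scale1r ?scale0r.
Qed.

HB.instance Definition _ (v : V) :=
  GRing.isLinear.Build K _ _ *:%R (lcons v) (lcons_linear v).

(** A cut of a nonempty word is either in front of its first letter, or a cut of
    the remaining word. *)
Lemma Tcomult_lcons (v : V) t :
  Tcomult (lcons v t) = Tone ⊗ lcons v t + tmap (lcons v) idfun (Tcomult t).
Proof.
move: t; apply: linear_eq_hword => [||x].
- exact: comp_linear Tcomult_linear (@lcons_linear _ _ _).
- apply: add_linear.
    exact: comp_linear ((tpure_bilinear _ _).2 _) (@lcons_linear _ _ _).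
  exact: comp_linear (@tmap_linear _ _ _ _ _ _ _) Tcomult_linear.
- rewrite Tcomult_hword linear_sum lconsE TcomultE /= big_ord_recl /=.
  congr (_ + _); under [RHS]eq_bigr => p _ do rewrite /= tmapE /=.
  rewrite -big_splits_take_drop size_map; apply: eq_bigr => i _ /=.
  by rewrite lconsE /hword map_take map_drop.
Qed.

End HomogeneousWords.

(** * The quasi-shuffle product *)

(** Lifting in one variable and then in the other is linear in both: for the first
    variable this is proved by decomposing the second argument into words, and
    conversely. *)
Lemma Tclift2P (K : fieldType) (V W : lmodType K)
    (f : seq V -> seq V -> W) :
  (forall w1, multilinear (f w1)) -> (forall w2, multilinear (f^~ w2)) ->
  let g s t := Tclift (fun w1 => Tclift (f w1) t) s : W in
  (forall w1 w2, g (word w1) (word w2) = f w1 w2) /\ bilinear_for *:%R *:%R g.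
Proof.
move=> fr fl /=.
have fl' t : multilinear (fun w1 => Tclift (f w1) t).
  move=> w1 a x y w2; elim/Tc_ind: t => [|c s t IHs IHt|w].
  - by rewrite !(linear_eq0 (Tclift_linear _)) // scaler0 addr0.
  - rewrite !(Tclift_linear (fr _)) IHs IHt !scalerDr !scalerA (mulrC c) -!addrA.
    by congr (_ + _); rewrite addrCA.
  - by rewrite !TcliftE //; apply: fl.
split; last split=> [t|s]; [|exact: Tclift_linear|].
  by move=> w1 w2; rewrite !TcliftE.
move=> c t t' /=; elim/Tc_ind: s => [|b s s' IHs IHs'|w].
- by rewrite !(linear_eq0 (Tclift_linear _)) // scaler0 addr0.
- rewrite !(Tclift_linear (fl' _)) IHs IHs' !scalerDr !scalerA (mulrC b) -!addrA.
  by congr (_ + _); rewrite addrCA.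
- by rewrite !TcliftE //; apply: Tclift_linear.
Qed.

Section QuasiShuffle.

Variables (K : fieldType) (V : gradedType K) (A : dgAlgebra V).
Implicit Types (a b : hletter V) (x y z : seq (hletter V)).

(** The only possible value of p1 o mu: the first two terms are imposed by the unit,
    the last one by the product of V.  It is the V-component of the product of the
    unitalization of V, pulled back along T^c(V) -> K + V. *)
Definition qsproj_pair (s t : Tc V) : V :=
  (Tcounit s : K) *: Tproj1 t + (Tcounit t : K) *: Tproj1 s +
  dg_mul A (Tproj1 s) (Tproj1 t).

Lemma qsproj_bilinear : bilinear_for *:%R *:%R qsproj_pair.
Proof.
apply: add_bilinear; [apply: add_bilinear|]; split=> [t|s].
- exact: (scale_linear _ Tcounit_linear).
- by move=> c u v; rewrite /= Tproj1_linear scalerDr !scalerA mulrC.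
- by move=> c u v; rewrite /= Tproj1_linear scalerDr !scalerA mulrC.
- exact: (scale_linear _ Tcounit_linear).
- by move=> c u v; rewrite /= Tproj1_linear linearPl.
- by move=> c u v; rewrite /= Tproj1_linear linearPr.
Qed.

Definition qsproj : tens (Tc V) (Tc V) -> V := tlift qsproj_pair.

Lemma qsproj_linear : linear qsproj.
Proof. exact: tlift_linear qsproj_bilinear. Qed.

Lemma qsprojE s t : qsproj (s ⊗ t) = qsproj_pair s t.
Proof. exact: tliftE qsproj_bilinear _ _. Qed.

Lemma TTcounit_linear : linear (@TTcounit K V).
Proof.
apply: tlift_linear; split=> [t|s] c u v /=.
  by rewrite linearP /= mulrDl -mulrA.
by rewrite linearP /= mulrDr mulrCA.
Qed.

Lemma TTcomult_linear : linear (@TTcomult K V).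
Proof.
move=> c u v; rewrite /TTcomult.
rewrite (@tmap_linear K _ _ _ _ (@Tcomult K V) (@Tcomult K V) c u v).
exact: (@tmiddle_linear K (Tc V) (Tc V) (Tc V) (Tc V) c _ _).
Qed.

(** One unfolding of the recursion: [F] takes the place of the product on the
    second half of the coproduct. *)
Definition qsstep (F : tens (Tc V) (Tc V) -> Tc V) :
    tens (tens (Tc V) (Tc V)) (tens (Tc V) (Tc V)) -> Tc V :=
  tlift (fun s t : tens (Tc V) (Tc V) => lcons (qsproj s) (F t)).

Lemma qsstep_bilinear F : linear F ->
  bilinear_for *:%R *:%R (fun s t : tens (Tc V) (Tc V) => lcons (qsproj s) (F t)).
Proof.
move=> lF; split=> [t|s] c u v /=; first by rewrite qsproj_linear linearPl.
by rewrite lF linearPr.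
Qed.

Lemma qsstep_linear F : linear F -> linear (qsstep F).
Proof. by move=> lF; exact: tlift_linear (qsstep_bilinear lF). Qed.

Lemma qsstepE F s t : linear F -> qsstep F (s ⊗ t) = lcons (qsproj s) (F t).
Proof. by move=> lF; exact: tliftE (qsstep_bilinear lF) _ _. Qed.

(** The recursion for the product is well founded only on words, whereas its
    right-hand side is a linear map on tensors; bounding the number of unfoldings
    keeps each approximation linear, and on words of total length at most [n] the
    [n]-th one is exact. *)
Fixpoint qsfuel (n : nat) (t : tens (Tc V) (Tc V)) : Tc V :=
  (TTcounit t : K) *: Tone +
  (if n is m.+1 then qsstep (qsfuel m) (TTcomult t) else 0).

Lemma qsfuel_linear n : linear (qsfuel n).
Proof.
elim: n => [|n IH] /=.
  apply: add_linear; first exact: (scale_linear _ TTcounit_linear).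
  by move=> c u v; rewrite scaler0 addr0.
apply: add_linear; first exact: (scale_linear _ TTcounit_linear).
exact: comp_linear (qsstep_linear IH) TTcomult_linear.
Qed.

Definition qsproj_words x y : V := qsproj (hword x ⊗ hword y).

Lemma qsproj_nil : qsproj_words [::] [::] = 0.
Proof.
by rewrite /qsproj_words qsprojE /qsproj_pair Tproj1_hword !scaler0 linear0l !addr0.
Qed.

Lemma qsfuelS n x y :
  qsfuel n.+1 (hword x ⊗ hword y) =
    (nilp x && nilp y)%:R *: Tone +
    \sum_(p <- splits x) \sum_(q <- splits y) (-1) ^ (wdeg p.2 * wdeg q.1) *:
      lcons (qsproj_words p.1 q.1) (qsfuel n (hword p.2 ⊗ hword q.2)).
Proof.
rewrite /= TTcounitE !Tcounit_hword -natrM mulnb; congr (_ + _).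
rewrite (TTcomult_hword (qsstep_linear (qsfuel_linear n))).
apply: eq_bigr => p _; apply: eq_bigr => q _.
by rewrite qsstepE //; apply: qsfuel_linear.
Qed.

Lemma qsfuel_nil n : qsfuel n (hword [::] ⊗ hword [::]) = Tone.
Proof.
case: n => [|n].
  by rewrite /= TTcounitE !Tcounit_hword mulr1 scale1r addr0.
by rewrite qsfuelS !big_splits_nil /= qsproj_nil linear0l scaler0 scale1r addr0.
Qed.

(** Conilpotence: a term of the recursion whose second half is not shorter has
    1 (x) 1 as first half, and there the projection vanishes.  This is what all
    the inductions on total length below rest on. *)
Lemma qsproj_words_smaller x y p1 p2 q1 q2 : x = p1 ++ p2 -> y = q1 ++ q2 ->
  qsproj_words p1 q1 = 0 \/ (size p2 + size q2 < size x + size y)%N.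
Proof.
move=> -> ->; rewrite !size_cat.
case: p1 q1 => [|a p1] [|b q1]; [by left; apply: qsproj_nil|right..]; rewrite /=; lia.
Qed.

Lemma qsfuel_stable m n x y :
  (size x + size y <= m)%N -> (size x + size y <= n)%N ->
  qsfuel m (hword x ⊗ hword y) = qsfuel n (hword x ⊗ hword y).
Proof.
elim: m n x y => [|m IH] [|n] x y; first by [].
- by case: x y => [|? ?] [|? ?] // _ _; rewrite !qsfuel_nil.
- by case: x y => [|? ?] [|? ?] // _ _; rewrite !qsfuel_nil.
move=> xym xyn; rewrite !qsfuelS; congr (_ + _).
apply: eq_big_splits => p1 p2 xE; apply: eq_big_splits => q1 q2 yE; congr (_ *: _).
have [->|lt] := qsproj_words_smaller xE yE; first by rewrite !linear0l.
by rewrite (IH n) //=; lia.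
Qed.

(** The fuel depends on the words only through their lengths, so the lift to
    tensors is still multilinear. *)
Definition qsmul : tens (Tc V) (Tc V) -> Tc V :=
  tlift (fun s t => Tclift (fun w1 => Tclift
    (fun w2 => qsfuel (size w1 + size w2) (word w1 ⊗ word w2)) t) s).

Let qsmulP :
  (forall w1 w2, Tclift (fun w1 => Tclift
     (fun w2 => qsfuel (size w1 + size w2) (word w1 ⊗ word w2)) (word w2)) (word w1) =
     qsfuel (size w1 + size w2) (word w1 ⊗ word w2)) /\
  bilinear_for *:%R *:%R (fun s t => Tclift (fun w1 => Tclift
     (fun w2 => qsfuel (size w1 + size w2) (word w1 ⊗ word w2)) t) s).
Proof.
by apply: Tclift2P => w w1 c u v w2 /=;
  rewrite word_multilinear ?linearPl ?linearPr qsfuel_linear !size_cat.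
Qed.

Lemma qsmul_linear : linear qsmul.
Proof. exact: (tlift_linear qsmulP.2). Qed.

HB.instance Definition _ := GRing.isLinear.Build K _ _ *:%R qsmul qsmul_linear.

Definition qsmul_words x y := qsmul (hword x ⊗ hword y).

(** The quasi-shuffle recursion: a nonzero term puts in front the first letter of
    [x], the first letter of [y], or their product. *)
Lemma qsmul_rec x y :
  qsmul_words x y = (nilp x && nilp y)%:R *: Tone +
    \sum_(p <- splits x) \sum_(q <- splits y) (-1) ^ (wdeg p.2 * wdeg q.1) *:
      lcons (qsproj_words p.1 q.1) (qsmul_words p.2 q.2).
Proof.
have qsE u v : qsmul_words u v = qsfuel (size u + size v) (hword u ⊗ hword v).
  by rewrite /qsmul_words /qsmul (tliftE qsmulP.2) qsmulP.1 !size_map.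
rewrite qsE (@qsfuel_stable _ (size x + size y).+1) // qsfuelS; congr (_ + _).
apply: eq_big_splits => p1 p2 xE; apply: eq_big_splits => q1 q2 yE /=.
by rewrite qsE (@qsfuel_stable _ (size p2 + size q2)) // xE yE !size_cat; lia.
Qed.

End QuasiShuffle.

Section QuasiShuffleLaws.

Variables (K : fieldType) (V : gradedType K) (A : dgAlgebra V).
Implicit Types (a b : hletter V) (x y z : seq (hletter V)).

Local Notation ph := (qsproj_words A).
Local Notation mm := (qsmul_words A).

Lemma qsproj_words_nill y : ph [::] y = Tproj1 (hword y).
Proof.
rewrite /qsproj_words qsprojE /qsproj_pair !Tcounit_hword (Tproj1_hword [::]).
by rewrite scale1r scaler0 linear0l !addr0.
Qed.

Lemma qsproj_words_nilr x : ph x [::] = Tproj1 (hword x).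
Proof.
rewrite /qsproj_words qsprojE /qsproj_pair !Tcounit_hword (Tproj1_hword [::]).
by rewrite scale1r scaler0 linear0r addr0 add0r.
Qed.

Lemma qsmul_words_nill x : mm [::] x = hword x.
Proof.
elim: x => [|a x IH]; rewrite qsmul_rec !big_splits_nil.
  by rewrite qsproj_nil linear0l scaler0 addr0 scale1r.
rewrite scale0r add0r big_splits_cons qsproj_nil linear0l scaler0 add0r.
rewrite big_splits_left => [|b u v _].
  by rewrite mul0r expr0z scale1r IH qsproj_words_nill Tproj1_hword lcons_hword.
by rewrite qsproj_words_nill Tproj1_hword linear0l scaler0.
Qed.

Lemma qsmul_words_nilr x : mm x [::] = hword x.
Proof.
elim: x => [|a x IH]; first exact: qsmul_words_nill.
rewrite qsmul_rec scale0r add0r big_splits_cons !big_splits_nil.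
rewrite qsproj_nil linear0l scaler0 add0r.
rewrite big_splits_left => [|b u v _]; rewrite big_splits_nil.
  by rewrite mulr0 expr0z scale1r IH qsproj_words_nilr Tproj1_hword lcons_hword.
by rewrite qsproj_words_nilr Tproj1_hword linear0l scaler0.
Qed.

Lemma qsmul1l t : qsmul A (Tone ⊗ t) = t.
Proof.
move: t; apply: linear_eq_hword => [c u v||x] //; last exact: qsmul_words_nill.
by rewrite linearPr linearP.
Qed.

Lemma qsmul1r t : qsmul A (t ⊗ Tone) = t.
Proof.
move: t; apply: linear_eq_hword => [c u v||x] //; last exact: qsmul_words_nilr.
by rewrite linearPl linearP.
Qed.

Lemma homog_Tproj1 n t : homog n t -> homog n (@Tproj1 K V t).
Proof.
suff deg : has_degree 0 (@Tproj1 K V) by move=> /deg; rewrite addr0.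
apply: has_degree_hword => x; rewrite addr0 /= Tproj1_hword.
by case: x => [|a [|b x]] /=; [exact: homog0|rewrite addr0; exact: hvalP|exact: homog0].
Qed.

Lemma homog_qsproj_words x y : homog (wdeg x + wdeg y) (ph x y).
Proof.
case: x => [|a x].
  by rewrite add0r qsproj_words_nill; apply/homog_Tproj1/homog_hword.
case: y => [|b y].
  by rewrite addr0 qsproj_words_nilr; apply/homog_Tproj1/homog_hword.
rewrite /qsproj_words qsprojE /qsproj_pair !Tcounit_hword !scale0r !add0r.
by apply: dg_mul_degree; apply/homog_Tproj1/homog_hword.
Qed.

Lemma homog_qsmul_words x y : homog (wdeg x + wdeg y) (mm x y).
Proof.
have [n] := ubnP (size x + size y); elim: n x y => // n IH x y lt_n.
rewrite qsmul_rec; apply: homogD.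
  case: x y {lt_n} => [|a x] [|b y]; rewrite /= ?scale0r; try exact: homog0.
  exact/homogZ/(@homog_hword K V [::]).
rewrite /homog linear_sum; apply: eq_big_splits => p1 p2 xE.
rewrite linear_sum; apply: eq_big_splits => q1 q2 yE; apply: homogZ => /=.
have [->|lt] := qsproj_words_smaller A xE yE; first by rewrite linear0l; apply: homog0.
have -> : wdeg x + wdeg y = (wdeg p1 + wdeg q1) + (wdeg p2 + wdeg q2).
  by rewrite xE yE !wdeg_cat; ring.
by apply: homog_lcons (homog_qsproj_words _ _) (IH _ _ _); lia.
Qed.

Lemma Tcounit_qsmul_words x y : Tcounit (mm x y) = (nilp x && nilp y)%:R.
Proof.
rewrite qsmul_rec linearD linearZ /= (Tcounit_hword [::]) !linear_sum.
rewrite big1 ?addr0; first exact: mulr1.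
move=> p _; rewrite linear_sum big1 // => q _.
by rewrite linearZ /= Tcounit_lcons scaler0.
Qed.

(** Only the cut leaving nothing on the right has a second factor with a nonzero
    scalar part. *)
Lemma Tproj1_qsmul_words x y : Tproj1 (mm x y) = ph x y.
Proof.
rewrite qsmul_rec linearD linearZ /= (Tproj1_hword [::]) scaler0 add0r linear_sum.
rewrite big_splits_right => [|u a v _]; rewrite linear_sum.
  rewrite big_splits_right => [|u a v _]; rewrite linearZ /= Tproj1_lcons.
    by rewrite Tcounit_qsmul_words mul0r expr0z !scale1r.
  by rewrite Tcounit_qsmul_words scale0r scaler0.
by rewrite big1 // => q _; rewrite linearZ /= Tproj1_lcons Tcounit_qsmul_words
  scale0r scaler0.
Qed.

(** Expanding the left side by the recursion and induction, and the right side by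
    the recursion in its first factor, gives the same sum over the cuts of [x] and
    [y] into three pieces, bracketed in the two possible ways. *)
Lemma Tcomult_qsmul_words x y :
  Tcomult (mm x y) =
    \sum_(p <- splits x) \sum_(q <- splits y) (-1) ^ (wdeg p.2 * wdeg q.1) *:
      (mm p.1 q.1 ⊗ mm p.2 q.2).
Proof.
have [n] := ubnP (size x + size y); elim: n x y => // n IH x y lt_n.
pose T (u : V) (s : tens (Tc V) (Tc V)) : tens (Tc V) (Tc V) :=
  tmap (lcons u) idfun s.
have TE u (s t : Tc V) : T u (s ⊗ t) = lcons u s ⊗ t by exact: tmapE.
have lT u : linear (T u) by exact: tmap_linear.
have T0 s : T 0 s = 0.
  elim/tens_ind: s => [|c s t IHs IHt|s t]; first exact: linear_eq0.
    by rewrite lT IHs IHt scaler0 addr0.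
  by rewrite TE !linear0l.
pose F x1 x2 x3 y1 y2 y3 : tens (Tc V) (Tc V) :=
  (-1) ^ ((wdeg x2 + wdeg x3) * wdeg y1 + wdeg x3 * wdeg y2) *:
    (lcons (ph x1 y1) (mm x2 y2) ⊗ mm x3 y3).
transitivity (Tone ⊗ mm x y + \sum_(p <- splits x) \sum_(q <- splits y)
    \sum_(p' <- splits p.2) \sum_(q' <- splits q.2)
      F p.1 p'.1 p'.2 q.1 q'.1 q'.2).
  rewrite {1}qsmul_rec linearD linearZ /= TcomultE big_ord1 /=.
  rewrite [in RHS]qsmul_rec linearDr linearZr_LR -addrA; congr (_ + _).
  rewrite !linear_sum -big_split; apply: eq_big_splits => p1 p2 xE.
  rewrite !linear_sum -big_split; apply: eq_big_splits => q1 q2 yE.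
  rewrite linearZ /= Tcomult_lcons scalerDr linearZr_LR; congr (_ + _).
  rewrite -/(T _ _).
  have [ph0|lt] := qsproj_words_smaller A xE yE.
    rewrite ph0 T0 scaler0 big1 // => p' _; rewrite big1 // => q' _.
    by rewrite /F ph0 !linear0l scaler0.
  rewrite IH; last lia.
  rewrite (linear_bigsum (lT _)) scaler_sumr; apply: eq_big_splits => p' p'' p2E.
  rewrite (linear_bigsum (lT _)) scaler_sumr; apply: eq_big_splits => q' q'' q2E.
  by rewrite (linear_Z (lT _)) scalerA TE -signzD p2E wdeg_cat.
rewrite splits_coassoc2.
transitivity (\sum_(p <- splits x) \sum_(q <- splits y)
  ((nilp p.1 && nilp q.1)%:R *: (Tone ⊗ mm p.2 q.2) +
   \sum_(p' <- splits p.1) \sum_(q' <- splits q.1)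
      F p'.1 p'.2 p.2 q'.1 q'.2 q.2)).
  under [RHS]eq_bigr => p _ do rewrite big_split.
  rewrite big_split; congr (_ + _).
  rewrite big_splits_left => [|a u v _]; last first.
    by rewrite big1 // => q _; rewrite scale0r.
  rewrite big_splits_left => [|a u v _]; last by rewrite scale0r.
  by rewrite scale1r.
apply: eq_bigr => -[p1 p2] _; apply: eq_bigr => -[q1 q2] _ /=.
rewrite [in RHS]qsmul_rec linearDl linearZl_LR scalerDr scalerA; congr (_ + _).
  by case: p1 q1 => [|a p1] [|b q1] /=; rewrite ?mulr0 ?expr0z ?mul1r.
rewrite linear_sumlz scaler_sumr; apply: eq_big_splits => p' p'' p1E.
rewrite linear_sumlz scaler_sumr; apply: eq_big_splits => q' q'' q1E.
rewrite /F /= linearZl_LR scalerA -signzD q1E wdeg_cat /=; congr (_ *: _).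
by congr (_ ^ _); ring.
Qed.

End QuasiShuffleLaws.

Section QuasiShuffleAssociativity.

Variables (K : fieldType) (V : gradedType K) (A : dgAlgebra V).
Implicit Types (a b : hletter V) (x y z : seq (hletter V)).

Local Notation ph := (qsproj_words A).
Local Notation mm := (qsmul_words A).

(** The recursion as an identity of linear maps, which allows arguments that are
    themselves products. *)
Lemma qsmul_fix t : qsmul A t =
  (TTcounit t : K) *: Tone + qsstep A (qsmul A) (TTcomult t).
Proof.
have lS := qsstep_linear A (qsmul_linear A).
move: t; apply: linear_eq_hword2 => [||x y]; first exact: qsmul_linear.
  apply: add_linear; first exact: (scale_linear _ (@TTcounit_linear K V)).
  exact: comp_linear lS (@TTcomult_linear K V).
rewrite -/(qsmul_words A x y) qsmul_rec TTcounitE !Tcounit_hword.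
rewrite -natrM mulnb; congr (_ + _); rewrite (TTcomult_hword lS).
apply: eq_bigr => p _; apply: eq_bigr => q _.
by rewrite qsstepE //; apply: qsmul_linear.
Qed.

Lemma qsmul_fix_pure s t : qsmul A (s ⊗ t) =
  (Tcounit s * Tcounit t : K) *: Tone +
  midswap (qsstep A (qsmul A)) (Tcomult s) (Tcomult t).
Proof. by rewrite qsmul_fix TTcounitE midswap_comult. Qed.

Lemma qsproj1l t : qsproj A (Tone ⊗ t) = Tproj1 t.
Proof.
rewrite qsprojE /qsproj_pair (Tcounit_hword [::]) (Tproj1_hword [::]).
by rewrite scale1r scaler0 linear0l !addr0.
Qed.

Lemma qsproj1r t : qsproj A (t ⊗ Tone) = Tproj1 t.
Proof.
rewrite qsprojE /qsproj_pair (Tcounit_hword [::]) (Tproj1_hword [::]).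
by rewrite scale1r scaler0 linear0r addr0 add0r.
Qed.

(** Associativity of the product of the unitalization of V; when no factor is
    empty it is the associativity of the product of V. *)
Lemma qsprojA x y z :
  qsproj A (hword x ⊗ mm y z) = qsproj A (mm x y ⊗ hword z).
Proof.
case: x => [|a x]; first by rewrite qsproj1l qsmul_words_nill Tproj1_qsmul_words.
case: z => [|c z]; first by rewrite qsproj1r qsmul_words_nilr Tproj1_qsmul_words.
case: y => [|b y]; first by rewrite qsmul_words_nill qsmul_words_nilr.
rewrite !qsprojE /qsproj_pair !Tcounit_qsmul_words !Tcounit_hword !scale0r !add0r.
rewrite !Tproj1_qsmul_words /qsproj_words !qsprojE /qsproj_pair !Tcounit_hword.
by rewrite !scale0r !add0r dg_mulA.
Qed.

(** The recursion for a product of three words; both bracketings satisfy it, with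
    the same signs, once their first letters are identified by [qsprojA]. *)
Definition qssum3 (G : seq (hletter V) -> seq (hletter V) -> seq (hletter V) -> Tc V)
    x y z : Tc V :=
  \sum_(p <- splits x) \sum_(q <- splits y) \sum_(r <- splits z)
    (-1) ^ (wdeg q.2 * wdeg r.1 + wdeg p.2 * (wdeg q.1 + wdeg r.1)) *:
      lcons (qsproj A (mm p.1 q.1 ⊗ hword r.1)) (G p.2 q.2 r.2).

Lemma qsmul_words3r x y z : qsmul A (hword x ⊗ mm y z) =
  [&& nilp x, nilp y & nilp z]%:R *: Tone +
  qssum3 (fun x y z => qsmul A (hword x ⊗ mm y z)) x y z.
Proof.
have lS := qsstep_linear A (qsmul_linear A).
rewrite qsmul_fix_pure Tcounit_hword Tcounit_qsmul_words -natrM mulnb.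
congr (_ + _); rewrite Tcomult_hword Tcomult_qsmul_words.
rewrite (bilinear_sum2 (midswap_bilinear lS)); apply: eq_bigr => p _.
apply: eq_bigr => q _; rewrite (linear_bigsum ((midswap_bilinear lS).2 _)).
apply: eq_bigr => r _; rewrite (linear_Z ((midswap_bilinear lS).2 _)) /=.
rewrite (midswapE lS _ _ (homog_hword _) (homog_qsmul_words _ _ _)).
by rewrite scalerA -signzD (qsstepE _ _ _ (qsmul_linear A)) qsprojA.
Qed.

Lemma qsmul_words3l x y z : qsmul A (mm x y ⊗ hword z) =
  [&& nilp x, nilp y & nilp z]%:R *: Tone +
  qssum3 (fun x y z => qsmul A (mm x y ⊗ hword z)) x y z.
Proof.
have lS := qsstep_linear A (qsmul_linear A).
rewrite qsmul_fix_pure Tcounit_hword Tcounit_qsmul_words andbA -natrM mulnb.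
congr (_ + _); rewrite Tcomult_hword Tcomult_qsmul_words.
rewrite (bilinear_sum2 (midswap_bilinear lS)); apply: eq_bigr => p _.
rewrite exchange_big; apply: eq_bigr => r _.
rewrite (linear_bigsum ((midswap_bilinear lS).1 _)).
apply: eq_bigr => q _; rewrite (linear_Z ((midswap_bilinear lS).1 _)) /=.
rewrite (midswapE lS _ _ (homog_qsmul_words _ _ _) (homog_hword _)).
rewrite scalerA -signzD (qsstepE _ _ _ (qsmul_linear A)).
by congr ((-1) ^ _ *: _); ring.
Qed.

Lemma qsmulA_words x y z : qsmul A (hword x ⊗ mm y z) = qsmul A (mm x y ⊗ hword z).
Proof.
have [n] := ubnP (size x + size y + size z); elim: n x y z => // n IH x y z lt_n.
rewrite qsmul_words3r qsmul_words3l; congr (_ + _).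
apply: eq_big_splits => p1 p2 xE; apply: eq_big_splits => q1 q2 yE.
apply: eq_big_splits => r1 r2 zE; congr (_ *: _) => /=.
have [|lt] : qsproj A (mm p1 q1 ⊗ hword r1) = 0 \/
    (size p2 + size q2 + size r2 < size x + size y + size z)%N.
- rewrite xE yE zE !size_cat.
  case: p1 q1 r1 {xE yE zE} => [|a p1] [|b q1] [|c r1] /=; [left|right; lia..].
  (* Three empty first parts: both factors are 1, whose product has no letter. *)
  by rewrite qsmul_words_nill; apply: qsproj_nil.
- by move=> ->; rewrite !linear0l.
- by rewrite IH //; lia.
Qed.

Lemma qsmulA (s t u : Tc V) :
  qsmul A (s ⊗ qsmul A (t ⊗ u)) = qsmul A (qsmul A (s ⊗ t) ⊗ u).
Proof.
move: s; apply: linear_eq_hword => [c s s'|c s s'|x].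
- by rewrite linearPl linearP.
- by rewrite linearPl linearP linearPl linearP.
move: t; apply: linear_eq_hword => [c s s'|c s s'|y].
- by rewrite linearPl linearP linearPr linearP.
- by rewrite linearPr linearP linearPl linearP.
move: u; apply: linear_eq_hword => [c s s'|c s s'|z].
- by rewrite linearPr linearP linearPr linearP.
- by rewrite linearPr linearP.
exact: qsmulA_words.
Qed.

End QuasiShuffleAssociativity.

(** * The differential *)

Section Differential.

Variables (K : fieldType) (V : gradedType K) (A : dgAlgebra V).
Implicit Types (a b : hletter V) (x y z : seq (hletter V)).

(** The sign of passing a letter is written with [koszul_sign], which is linear in
    the letter, to make the definition multilinear. *)
Fixpoint bardiff_word (w : seq V) : Tc V :=
  if w is v :: w' then
    lcons (dg_diff A v) (word w') + lcons (koszul_sign (-1) v) (bardiff_word w')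
  else 0.

Lemma bardiff_word_multilinear : multilinear bardiff_word.
Proof.
elim=> [|v w1 IH] c s t w2 /=.
  by rewrite !linearP !linearPl scalerDr addrACA.
by rewrite IH word_multilinear !linearPr scalerDr addrACA.
Qed.

Definition bardiff : Tc V -> Tc V := Tclift bardiff_word.

Lemma bardiff_linear : linear bardiff.
Proof. exact: Tclift_linear bardiff_word_multilinear. Qed.

HB.instance Definition _ :=
  GRing.isLinear.Build K _ _ *:%R bardiff bardiff_linear.

Lemma bardiff1 : bardiff Tone = 0.
Proof. exact: (TcliftE bardiff_word_multilinear). Qed.

Lemma bardiff_lcons n v t : homog n v ->
  bardiff (lcons v t) =
    lcons (dg_diff A v) t + (-1) ^ (-1 * n) *: lcons v (bardiff t).
Proof.
move=> nv; move: t; apply: linear_eq_hword => [||x].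
- exact: comp_linear bardiff_linear (@lcons_linear _ _ _).
- apply: add_linear; first exact: lcons_linear.
  move=> c s t; rewrite bardiff_linear linearPr scalerDr !scalerA.
  by rewrite mulrC.
rewrite /bardiff /hword lconsE !(TcliftE bardiff_word_multilinear) /=.
by rewrite (koszul_signE _ nv) linearZl_LR.
Qed.

Lemma bardiff_cons a x : bardiff (hword (a :: x)) =
  lcons (dg_diff A (hval a)) (hword x) +
  (-1) ^ (-1 * hdeg a) *: lcons a (bardiff (hword x)).
Proof. by rewrite -lcons_hword (bardiff_lcons _ (hvalP a)). Qed.

Lemma homog_bardiff x : homog (wdeg x + -1) (bardiff (hword x)).
Proof.
elim: x => [|a x IH]; first by rewrite bardiff1; apply: homog0.
rewrite bardiff_cons; apply: homogD.
  have -> : wdeg (a :: x) + -1 = (hdeg a + -1) + wdeg x by rewrite /=; ring.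
  by apply: homog_lcons (homog_hword _); apply/dg_diff_degree/hvalP.
by apply: homogZ; rewrite /= -addrA; apply: homog_lcons (hvalP a) IH.
Qed.

Lemma Tcounit_bardiff x : Tcounit (bardiff (hword x)) = 0.
Proof.
case: x => [|a x]; first by rewrite bardiff1 linear0.
by rewrite bardiff_cons linearD linearZ /= !Tcounit_lcons scaler0 addr0.
Qed.

Lemma Tproj1_bardiff t : Tproj1 (bardiff t) = dg_diff A (Tproj1 t).
Proof.
move: t; apply: linear_eq_hword => [||x].
- exact: comp_linear Tproj1_linear bardiff_linear.
- exact: comp_linear (linearP (dg_diff A)) Tproj1_linear.
case: x => [|a x]; first by rewrite bardiff1 Tproj1_hword !linear0.
rewrite bardiff_cons linearD linearZ /= !Tproj1_lcons Tcounit_bardiff scale0r.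
rewrite scaler0 addr0 Tcounit_hword Tproj1_hword.
by case: x => [|b x]; rewrite ?scale1r // scale0r linear0.
Qed.

Lemma signz_pred n : (-1) ^ (-1 * (n + -1)) = - (-1) ^ (-1 * n) :> K.
Proof. by rewrite mulrDr signzD mulrN1. Qed.

(** The two cross terms cancel since the differential lowers the degree of the
    letter by one, which flips the sign of passing it. *)
Lemma bardiff2 t : bardiff (bardiff t) = 0.
Proof.
move: t; apply: linear_eq_hword => [||x].
- exact: comp_linear bardiff_linear bardiff_linear.
- by move=> c s t; rewrite scaler0 addr0.
elim: x => [|a x IH]; first by rewrite bardiff1 linear0.
have da := dg_diff_degree A (hvalP a).
rewrite bardiff_cons linearD linearZ /= (bardiff_lcons _ da).
rewrite (bardiff_lcons _ (hvalP a)) IH dg_diff2 linear0l linear0r scaler0 addr0 add0r.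
by rewrite signz_pred scaleNr addNr.
Qed.

(** A differentiated letter lies on one side of the cut; on the right side it has
    been reached by passing the left part. *)
Lemma Tcomult_bardiff x :
  Tcomult (bardiff (hword x)) =
    \sum_(p <- splits x) (bardiff (hword p.1) ⊗ hword p.2 +
      (-1) ^ (-1 * wdeg p.1) *: (hword p.1 ⊗ bardiff (hword p.2))).
Proof.
elim: x => [|a x IH].
  by rewrite big_splits_nil bardiff1 !linear0 linear0l linear0r scaler0 addr0.
have TE u (s t : Tc V) : tmap (lcons u) idfun (s ⊗ t) = lcons u s ⊗ t.
  exact: tmapE.
have lT u : linear (tmap (@lcons K V u) (@idfun (Tc V))) by exact: tmap_linear.
rewrite big_splits_cons /= bardiff1 linear0l add0r mulr0 expr0z scale1r.
rewrite bardiff_cons linearD linearZ /= !Tcomult_lcons linearDr linearZr_LR.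
rewrite scalerDr addrACA; congr (_ + _).
rewrite IH Tcomult_hword !(linear_bigsum (lT _)) scaler_sumr -big_split.
apply: eq_bigr => p _.
rewrite /= !TE bardiff_cons linearDl linearZl_LR -addrA; congr (_ + _).
rewrite (linear_D (lT _)) TE (linear_Z (lT _)) TE scalerDr.
by rewrite scalerA -signzD -mulrDr lcons_hword.
Qed.

(** The differential of T^c(V) (x) T^c(V). *)
Definition tensdiff (t : tens (Tc V) (Tc V)) : tens (Tc V) (Tc V) :=
  tmap bardiff idfun t + tmap_deg (-1) idfun bardiff t.

Lemma tensdiff_linear : linear tensdiff.
Proof.
apply: add_linear; first exact: tmap_linear.
exact: (@tmap_deg_linear K (Tc V)).
Qed.

Lemma tensdiffE n s t : homog n s ->
  tensdiff (s ⊗ t) = bardiff s ⊗ t + (-1) ^ (-1 * n) *: (s ⊗ bardiff t).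
Proof.
move=> ns; rewrite /tensdiff tmapE; congr (_ + _).
exact: (@tmap_degE K (Tc V)).
Qed.

Lemma Tcomult_bardiffE t :
  Tcomult (bardiff t) =
    tmap bardiff idfun (Tcomult t) + tmap_deg (-1) idfun bardiff (Tcomult t).
Proof.
rewrite -/(tensdiff _); move: t; apply: linear_eq_hword => [||x].
- exact: comp_linear Tcomult_linear bardiff_linear.
- exact: comp_linear tensdiff_linear Tcomult_linear.
rewrite Tcomult_bardiff Tcomult_hword (linear_bigsum tensdiff_linear).
by apply: eq_bigr => p _; rewrite (tensdiffE _ (homog_hword _)).
Qed.

Lemma bardiff_degree : has_degree (-1) bardiff.
Proof. exact: has_degree_hword homog_bardiff. Qed.

(** The tensor product of two copies of the coalgebra is again a differential
    graded coalgebra: [tensdiff] is a coderivation for its coproduct. *)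
Lemma TTcomult_tensdiff (M : lmodType K)
    (L : tens (tens (Tc V) (Tc V)) (tens (Tc V) (Tc V)) -> M) x y : linear L ->
  L (TTcomult (tensdiff (hword x ⊗ hword y))) =
    \sum_(p <- splits x) \sum_(q <- splits y) (-1) ^ (wdeg p.2 * wdeg q.1) *:
      (L (tensdiff (hword p.1 ⊗ hword q.1) ⊗ (hword p.2 ⊗ hword q.2)) +
       (-1) ^ (-1 * (wdeg p.1 + wdeg q.1)) *:
       L ((hword p.1 ⊗ hword q.1) ⊗ tensdiff (hword p.2 ⊗ hword q.2))).
Proof.
move=> lL; have lLT := comp_linear lL (@TTcomult_linear K V).
have bm := midswap_bilinear lL.
have Ll t : linear (fun s => L (s ⊗ t)).
  by apply: (comp_linear lL) => c u v; rewrite linearPl.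
have Lr s : linear (fun t => L (s ⊗ t)).
  by apply: (comp_linear lL) => c u v; rewrite linearPr.
rewrite (tensdiffE _ (homog_hword x)) (linear_D lLT) (linear_Z lLT).
rewrite -!midswap_comult !Tcomult_bardiff !Tcomult_hword !(bilinear_sum2 bm).
rewrite scaler_sumr -big_split; apply: eq_big_splits => p1 p2 xE.
rewrite scaler_sumr -big_split; apply: eq_bigr => -[q1 q2] _ /=.
rewrite (linear_D (bm.1 _)) (linear_D (bm.2 _)) (linear_Z (bm.1 _)).
rewrite (linear_Z (bm.2 _)).
rewrite (midswapE lL _ _ (homog_hword p2) (homog_hword q1)).
rewrite (midswapE lL _ _ (homog_bardiff p2) (homog_hword q1)).
rewrite (midswapE lL _ _ (homog_hword p2) (homog_bardiff q1)).
rewrite (midswapE lL _ _ (homog_hword p2) (homog_hword q1)).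
rewrite !(tensdiffE _ (homog_hword _)).
rewrite (linear_D (Ll _)) (linear_D (Lr _)) (linear_Z (Ll _)) (linear_Z (Lr _)).
rewrite !scalerDr !scalerA -!signzD.
rewrite addrACA xE wdeg_cat; congr (_ + _ *: _ + (_ *: _ + _ *: _)).
(* The differential of y passes all of x, and the exchange of the second part of
   x with the first part of y sees a degree one lower: together this passes the
   second part of x twice. *)
- by apply: (@signz_eq K (- wdeg p2)); ring.
- by congr (_ ^ _); ring.
- by congr (_ ^ _); ring.
Qed.

Local Notation ph := (qsproj_words A).
Local Notation mm := (qsmul_words A).

(** The Leibniz rule, extended to the unitalization of V with the differential of
    the unit equal to 0. *)
Lemma qsproj_tensdiff x y :
  qsproj A (tensdiff (hword x ⊗ hword y)) = dg_diff A (ph x y).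
Proof.
have dp z : Tproj1 (bardiff (hword z)) = dg_diff A (Tproj1 (hword z)).
  exact: Tproj1_bardiff.
rewrite (tensdiffE _ (homog_hword x)) (linear_D (qsproj_linear A)).
rewrite (linear_Z (qsproj_linear A)) /qsproj_words.
case: x => [|a x].
  rewrite bardiff1 linear0l (linear_eq0 (qsproj_linear A)) add0r.
  by rewrite mulr0 expr0z scale1r !qsproj1l dp.
case: y => [|b y].
  rewrite bardiff1 linear0r (linear_eq0 (qsproj_linear A)) scaler0 addr0.
  by rewrite !qsproj1r dp.
rewrite !qsprojE /qsproj_pair !Tcounit_bardiff !Tcounit_hword !scale0r !add0r !dp.
rewrite (dg_leibniz A _ (homog_Tproj1 (homog_hword (a :: x)))); congr (_ + _ *: _).
by apply: (@signz_eq K (- wdeg (a :: x))); ring.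
Qed.

(** Both sides obey one recursion, because d and [tensdiff] are coderivations: the
    differential falls either on the first letter, where [qsproj_tensdiff] applies,
    or on the remaining product, where induction does. *)
Lemma bardiff_qsmul_words x y :
  bardiff (mm x y) = qsmul A (tensdiff (hword x ⊗ hword y)).
Proof.
have [n] := ubnP (size x + size y); elim: n x y => // n IH x y lt_n.
have lS := qsstep_linear A (qsmul_linear A).
rewrite [LHS](congr1 bardiff (qsmul_rec _ _ _)) linearD linearZ /= bardiff1.
rewrite scaler0 add0r qsmul_fix (TTcomult_tensdiff _ _ lS).
have -> : TTcounit (tensdiff (hword x ⊗ hword y)) = 0.
  rewrite (tensdiffE _ (homog_hword x)) (linear_D (@TTcounit_linear K V)).
  rewrite (linear_Z (@TTcounit_linear K V)) !TTcounitE.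
  by rewrite !Tcounit_bardiff mul0r mulr0 scaler0 addr0.
rewrite scale0r add0r linear_sum; apply: eq_big_splits => p1 p2 xE.
rewrite linear_sum; apply: eq_big_splits => q1 q2 yE; rewrite linearZ /=.
congr (_ *: _); rewrite (bardiff_lcons _ (homog_qsproj_words A p1 q1)).
rewrite !(qsstepE _ _ _ (qsmul_linear A)) qsproj_tensdiff; congr (_ + _ *: _).
have [ph0|lt] := qsproj_words_smaller A xE yE.
  by rewrite -/(qsproj_words A p1 q1) ph0 !linear0l.
by rewrite IH //; lia.
Qed.

Lemma bardiff_qsmul t : bardiff (qsmul A t) = qsmul A (tensdiff t).
Proof.
move: t; apply: linear_eq_hword2 => [||x y].
- exact: comp_linear bardiff_linear (qsmul_linear A).
- exact: comp_linear (qsmul_linear A) tensdiff_linear.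
exact: bardiff_qsmul_words.
Qed.

End Differential.

(** * Uniqueness *)

Section Reconstruction.

Variables (K : fieldType) (V : gradedType K).
Implicit Types (a b : hletter V) (x y z : seq (hletter V)).

Definition peel : tens (Tc V) (Tc V) -> Tc V :=
  tlift (fun s t => lcons (Tproj1 s) t).

Lemma peel_bilinear :
  bilinear_for *:%R *:%R (fun s t : Tc V => lcons (Tproj1 s) t).
Proof.
split=> [t|s] c u v /=; first by rewrite linearP linearPl.
by rewrite linearPr.
Qed.

Lemma peel_linear : linear peel.
Proof. exact: tlift_linear peel_bilinear. Qed.

Lemma peelE s t : peel (s ⊗ t) = lcons (Tproj1 s) t.
Proof. exact: tliftE peel_bilinear _ _. Qed.

(** Of all the cuts of a nonempty word, only the one after its first letter has a
    left part of length one. *)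
Lemma peel_Tcomult t : t = (Tcounit t : K) *: Tone + peel (Tcomult t).
Proof.
move: t; apply: linear_eq_hword => [//||x].
  apply: add_linear; first exact: (scale_linear _ Tcounit_linear).
  exact: comp_linear peel_linear Tcomult_linear.
rewrite Tcounit_hword Tcomult_hword (linear_bigsum peel_linear).
case: x => [|a x].
  by rewrite big_splits_nil peelE Tproj1_hword linear0l addr0 scale1r.
rewrite scale0r add0r big_splits_cons /= peelE (Tproj1_hword [::]) linear0l add0r.
rewrite big_splits_left => [|b u v _]; rewrite peelE Tproj1_hword.
  by rewrite lcons_hword.
by rewrite linear0l.
Qed.

Lemma Tcounit_Tlen k (t : Tc V) : Tcounit (Tlen k t) = (k == 0)%N%:R * Tcounit t.
Proof.
move: t; apply: linear_eq_hword => [c s t|c s t|x].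
- by rewrite !linearP.
- by rewrite linearP /= mulrDr mulrCA.
rewrite TlenE Tcounit_hword size_map eq_sym.
by case: x k => [|a x] [|k] /=; rewrite ?linear0 ?mul0r ?mulr0 //;
  [rewrite (Tcounit_hword [::]) mulr1
  |case: eqP => _; rewrite ?linear0 // (Tcounit_hword (a :: x))].
Qed.

Lemma Tproj1_Tlen k (t : Tc V) : Tproj1 (Tlen k t) = (k == 1)%N%:R *: Tproj1 t.
Proof.
move: t; apply: linear_eq_hword => [c s t|c s t|x].
- by rewrite !linearP.
- by rewrite linearP /= scalerDr !scalerA mulrC.
rewrite TlenE size_map eq_sym -/(hword x); case: (eqVneq k (size x)) => [->|neq].
  by rewrite Tproj1_hword; case: x => [|a [|b x]]; rewrite ?scale1r ?scaler0.
rewrite linear0 Tproj1_hword; case: x neq => [|a [|b x]]; rewrite ?scaler0 //=.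
by move=> /negPf ->; rewrite scale0r.
Qed.

Lemma Tbar_counit t : t \in @Tbar K V -> Tcounit t = 0.
Proof. by move=> /eqP t0; rewrite -[LHS]mul1r -(Tcounit_Tlen 0) t0 linear0. Qed.

Lemma Tbar_hword a x : hword (a :: x) \in @Tbar K V.
Proof. by rewrite /Tbar /in_mem /= TlenE. Qed.

Variables (A : dgAlgebra V) (B : Binfty V).
Hypothesis AB : Binduced A B.

(** The structure satisfies the recursion [qsmul_rec], by applying [peel_Tcomult]
    to its product; the unit laws settle the first letters when a word is empty,
    where the hypothesis says nothing. *)
Lemma Binduced_mul x y : Bmu B (hword x ⊗ hword y) = qsmul_words A x y.
Proof.
pose L t := peel (tmap (Bmu B) (Bmu B) t).
have lL : linear L by exact: comp_linear peel_linear (@tmap_linear _ _ _ _ _ _ _).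
have projE u v : Tproj1 (Bmu B (hword u ⊗ hword v)) = qsproj_words A u v.
  case: u => [|a u]; first by rewrite Bmu1l qsproj_words_nill.
  case: v => [|b v]; first by rewrite Bmu1r qsproj_words_nilr.
  rewrite AB.1 ?Tbar_hword // /qsproj_words qsprojE /qsproj_pair !Tcounit_hword.
  by rewrite !scale0r !add0r.
have [n] := ubnP (size x + size y); elim: n x y => // n IH x y lt_n.
rewrite [LHS]peel_Tcomult Bmu_comult -/(L _) (TTcomult_hword lL) Bmu_counit.
rewrite TTcounitE !Tcounit_hword -natrM mulnb qsmul_rec; congr (_ + _).
apply: eq_big_splits => p1 p2 xE; apply: eq_big_splits => q1 q2 yE; congr (_ *: _).
rewrite /L tmapE peelE projE /=.
have [->|lt] := qsproj_words_smaller A xE yE; first by rewrite !linear0l.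
by rewrite IH //; lia.
Qed.

Lemma Tcomult_Bd x : Tcomult (Bd B (hword x)) =
  \sum_(p <- splits x) (Bd B (hword p.1) ⊗ hword p.2 +
    (-1) ^ (-1 * wdeg p.1) *: (hword p.1 ⊗ Bd B (hword p.2))).
Proof.
rewrite Bd_coder Tcomult_hword !linear_sum -big_split; apply: eq_bigr => p _.
by rewrite /= tmapE (@tmap_degE K (Tc V) _ _ _ _ _ _ _ _ _ (homog_hword _)).
Qed.

(** Apply the counit to the left factor of the coproduct of d(x): the terms where d
    acts on the right add up to d(x) itself, so the others add up to 0, and their
    scalar part is that of d(x). *)
Lemma Tcounit_Bd x : Tcounit (Bd B (hword x)) = 0.
Proof.
pose cunit (s t : Tc V) := (Tcounit s : K) *: t.
have bc : bilinear_for *:%R *:%R cunit.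
  split=> [t|s]; first exact: (scale_linear _ Tcounit_linear).
  by move=> c u v; rewrite /cunit /= scalerDr !scalerA mulrC.
have lc := tlift_linear bc.
have counitK t : tlift cunit (Tcomult t) = t.
  move: t; apply: linear_eq_hword => [||y] //.
    exact: comp_linear lc Tcomult_linear.
  rewrite Tcomult_hword (linear_bigsum lc) big_splits_left => [|a u v _].
    by rewrite (tliftE bc) /cunit (Tcounit_hword [::]) scale1r.
  by rewrite (tliftE bc) /cunit Tcounit_hword scale0r.
have sum0 : \sum_(p <- splits x) (Tcounit (Bd B (hword p.1)) : K) *: hword p.2 = 0.
  apply: (addIr (Bd B (hword x))); rewrite add0r -[RHS]counitK Tcomult_Bd.
  rewrite (linear_bigsum lc).
  transitivity (\sum_(p <- splits x) ((Tcounit (Bd B (hword p.1)) : K) *: hword p.2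
    + (-1) ^ (-1 * wdeg p.1) *: ((nilp p.1)%:R *: Bd B (hword p.2)))).
    rewrite big_split; congr (_ + _).
    rewrite big_splits_left => [|a u v _]; last by rewrite scale0r scaler0.
    by rewrite mulr0 expr0z !scale1r.
  apply: eq_bigr => p _; rewrite (linear_D lc) (linear_Z lc) !(tliftE bc) /cunit.
  by rewrite Tcounit_hword.
have := congr1 (@Tcounit K V) sum0; rewrite linear_sum linear0.
rewrite big_splits_right => [|u a v _]; rewrite linearZ /= Tcounit_hword.
  by move=> /(etrans (esym (mulr1 _))).
exact: mulr0.
Qed.

Lemma Binduced_diff_rec x : Bd B (hword x) =
  \sum_(p <- splits x) (lcons (dg_diff A (Tproj1 (hword p.1))) (hword p.2) +
    (-1) ^ (-1 * wdeg p.1) *: lcons (Tproj1 (hword p.1)) (Bd B (hword p.2))).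
Proof.
have projE u : Tproj1 (Bd B (hword u)) = dg_diff A (Tproj1 (hword u)).
  case: u => [|a u]; first by rewrite Bd1 Tproj1_hword !linear0.
  by rewrite AB.2 ?Tbar_hword.
rewrite [LHS]peel_Tcomult Tcounit_Bd scale0r add0r Tcomult_Bd.
rewrite (linear_bigsum peel_linear); apply: eq_bigr => p _.
by rewrite (linear_D peel_linear) (linear_Z peel_linear) !peelE projE.
Qed.

End Reconstruction.

(** * The induced structure and its operations *)

Section Proposition.

Variables (K : fieldType) (V : gradedType K) (A : dgAlgebra V).

Lemma qsmul_degree : has_degree 0 (qsmul A).
Proof.
by apply: has_degree_hword2 => x y; rewrite addr0; apply: homog_qsmul_words.
Qed.

Lemma Tcomult_qsmul t :
  Tcomult (qsmul A t) = tmap (qsmul A) (qsmul A) (TTcomult t).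
Proof.
have lm : linear (tmap (qsmul A) (qsmul A)) by exact: tmap_linear.
move: t; apply: linear_eq_hword2 => [||x y].
- exact: comp_linear Tcomult_linear (qsmul_linear A).
- exact: comp_linear lm (@TTcomult_linear K V).
rewrite (TTcomult_hword lm) Tcomult_qsmul_words.
by apply: eq_bigr => p _; apply: eq_bigr => q _; rewrite tmapE.
Qed.

Lemma Tcounit_qsmul t : Tcounit (qsmul A t) = TTcounit t.
Proof.
move: t; apply: linear_eq_hword2 => [||x y].
- exact: comp_linear Tcounit_linear (qsmul_linear A).
- exact: TTcounit_linear.
by rewrite TTcounitE !Tcounit_hword -natrM mulnb Tcounit_qsmul_words.
Qed.

Lemma Tproj1_qsmul t : Tproj1 (qsmul A t) = qsproj A t.
Proof.
move: t; apply: linear_eq_hword2 => [||x y].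
- exact: comp_linear Tproj1_linear (qsmul_linear A).
- exact: qsproj_linear.
exact: Tproj1_qsmul_words.
Qed.

Definition qsBinfty : Binfty V :=
  BInfty qsmul_degree Tcomult_qsmul Tcounit_qsmul (@qsmulA K V A)
    (@qsmul1l K V A) (@qsmul1r K V A) (bardiff_degree A)
    (Tcomult_bardiffE A) (bardiff1 A) (bardiff2 A) (bardiff_qsmul A).

Lemma qsBinfty_induced : Binduced A qsBinfty.
Proof.
split=> [s t /Tbar_counit s0 /Tbar_counit t0|s _]; last exact: Tproj1_bardiff.
by rewrite Tproj1_qsmul qsprojE /qsproj_pair s0 t0 !scale0r !add0r.
Qed.

(** The recursion for d refers to d only on proper suffixes, since the empty prefix
    has no letter; it holds for both differentials. *)
Lemma Binduced_unique (B : Binfty V) : Binduced A B ->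
  Bmu B =1 qsmul A /\ Bd B =1 bardiff A.
Proof.
move=> AB; split.
  apply: linear_eq_hword2 => [||x y]; first exact: linearP.
    exact: qsmul_linear.
  exact: Binduced_mul.
apply: linear_eq_hword => [||x]; [exact: linearP|exact: bardiff_linear|].
have [n] := ubnP (size x); elim: n x => // n IH x lt_n.
rewrite (Binduced_diff_rec AB) -[bardiff A _]/(Bd qsBinfty _).
rewrite (Binduced_diff_rec qsBinfty_induced); apply: eq_big_splits => p1 p2 xE.
congr (_ + _ *: _); case: p1 xE => [|a p1] xE /=.
  by rewrite Tproj1_hword !linear0l.
by rewrite IH //; move: lt_n; rewrite xE /= size_cat; lia.
Qed.

Lemma qsproj_pair_scalarl c (v : V) :
  qsproj_pair A (c *: Tone) (word [:: v]) = c *: v.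
Proof.
rewrite /qsproj_pair !(linear_Z Tcounit_linear) !(linear_Z Tproj1_linear).
rewrite !TcounitE !Tproj1E scale0r !scaler0 linear0l !addr0.
by congr (_ *: _); apply: mulr1.
Qed.

Lemma qsproj_pair_scalarr c (v : V) :
  qsproj_pair A (word [:: v]) (c *: Tone) = c *: v.
Proof.
rewrite /qsproj_pair !(linear_Z Tcounit_linear) !(linear_Z Tproj1_linear).
rewrite !TcounitE !Tproj1E scale0r !scaler0 linear0r addr0 add0r.
by congr (_ *: _); apply: mulr1.
Qed.

Lemma Tcounit_tpow k (u : tpow V k) : Tcounit (val u) = (k == 0)%N%:R * Tcounit (val u).
Proof. by rewrite -Tcounit_Tlen (eqP (valP u)). Qed.

Lemma Tproj1_tpow k (u : tpow V k) : Tproj1 (val u) = (k == 1)%N%:R *: Tproj1 (val u).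
Proof. by rewrite -Tproj1_Tlen (eqP (valP u)). Qed.

Lemma Bop2_linear (B : Binfty V) i j : linear (@Bop2 K V B i j).
Proof. by move=> c s t; rewrite /Bop2 !linearP. Qed.

Lemma Bop2_qs i j (u : tpow V i) (w : tpow V j) :
  Bop2 qsBinfty (u ⊗ w) = qsproj_pair A (val u) (val w).
Proof. by rewrite /Bop2 Tproj1_qsmul tmapE qsprojE. Qed.

End Proposition.

Theorem proposition2p3p3 (K : fieldType) (V : gradedType K) (A : dgAlgebra V) :
  exists B : Binfty V,
    [/\ Binduced A B,
        forall B' : Binfty V, Binduced A B' -> Bmu B' =1 Bmu B /\ Bd B' =1 Bd B,
        (forall i j : nat, (i, j) \notin [:: (1, 1); (0, 1); (1, 0)]%N ->
           forall z : tens (tpow V i) (tpow V j), Bop2 B z = 0) /\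
        (forall n : nat, (0 < n)%N -> n != 1%N ->
           forall x : tpow V n, Bop1 B x = 0),
        (forall a b : V, Bop2 B (tpow1 a ⊗ tpow1 b) = dg_mul A a b) /\
        (forall a : V, Bop1 B (tpow1 a) = dg_diff A a)
      & forall (c : K) (a : V),
          Bop2 B (tpow0 V c ⊗ tpow1 a) = c *: a /\
          Bop2 B (tpow1 a ⊗ tpow0 V c) = c *: a].
Proof.
have val0 c : val (tpow0 V c) = c *: word [::] by rewrite /tpow0 linearZ.
exists (qsBinfty A); split.
- exact: qsBinfty_induced.
- exact: Binduced_unique.
- split=> [i j ij z|n _ /negPf n1 x]; last first.
    by rewrite /Bop1 Tproj1_bardiff Tproj1_tpow n1 scale0r linear0.
  elim/tens_ind: z => [|c s t IHs IHt|u w].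
  + exact: linear_eq0 (@Bop2_linear _ _ _ _ _).
  + by rewrite Bop2_linear IHs IHt scaler0 addr0.
  rewrite Bop2_qs /qsproj_pair (Tcounit_tpow u) (Tcounit_tpow w).
  rewrite (Tproj1_tpow u) (Tproj1_tpow w).
  by case: i j ij u w => [|[|i]] [|[|j]] //= _ u w;
    rewrite ?(mul0r, scale0r, scaler0, linear0l, linear0r, addr0).
- split=> [a b|a]; last by rewrite /Bop1 Tproj1_bardiff /= Tproj1E.
  by rewrite Bop2_qs /qsproj_pair /= !TcounitE !Tproj1E /= !scale0r !add0r.
move=> c a; split; rewrite Bop2_qs.
  exact: etrans (congr1 (qsproj_pair A ^~ _) (val0 c)) (qsproj_pair_scalarl _ _ _).
exact: etrans (congr1 (qsproj_pair A _) (val0 c)) (qsproj_pair_scalarr _ _ _).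
Qed.
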